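(* Let $\mathcal{X}$ be a non-empty class of complete metric spaces that, for some strictly increasing continuous function $\Theta\colon\mathbb{R}_{\geq 0}\to\mathbb{R}_{\geq 0}$, satisfies the assumptions $(\mathrm{S}_{+})$, $(\mathrm{U})$, $(\Theta\text{-}\mathrm{NPC}1)$, $(\mathrm{NPC}2)$, $(\mathrm{NPC}3)$ and $(\mathrm{TP})$ (defined in the context). Let $l\geq 3$ be an integer, let $G$ be a finitely generated group, let $M_1,\ldots,M_l\leqslant G$ be subgroups and let $\Pi\leqslant\mathrm{Aut}(G)$ be a subgroup. Assume that: $(i_l)$ the union $\bigcup_{i=1}^l M_i$ generates $G$; $(ii)$ the group $\Pi$ is finite; $(\mathrm{GAME}_l)$ the player has a winning strategy for the $(\mathrm{Game}_l)$ for $(M_1,\ldots,M_l,\Pi)$ (defined in the context). If $G\geqslant M_i$ has relative property $(\mathrm{F}_{\mathcal{X}})$ for every $1\leq i\leq l$, then $G$ has property $(\mathrm{F}_{\mathcal{X}})$. In addition, if moreover $\mathcal{X}$ consists either of Banach spaces or of $\mathrm{CAT}(0)$ spaces, then the same conclusion holds with hypothesis $(\mathrm{GAME}_l)$ relaxed to: $(\mathrm{GAME}_l^{+})$ the player has a winning strategy for the $(\mathrm{Game}_l^{+})$ for $(M_1,\ldots,M_l,\Pi)$.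
   Context: Conventions: all metric spaces are non-empty and complete; all group actions on metric spaces are by isometries. For an action $\alpha\colon \Lambda\curvearrowright X$ and $M\leqslant \Lambda$, $X^{\alpha(M)}=\{x\in X:\alpha(h)\cdot x=x \text{ for all } h\in M\}$. For a countable group $\Lambda$ and $M\leqslant\Lambda$, the pair $\Lambda\geqslant M$ has relative property $(\mathrm{F}_{\mathcal{X}})$ if for every $X\in\mathcal{X}$ and every action $\alpha\colon\Lambda\curvearrowright X$ one has $X^{\alpha(M)}\neq\emptyset$. A finitely generated group $G$ has property $(\mathrm{F}_{\mathcal{X}})$ if $G\geqslant G$ has relative property $(\mathrm{F}_{\mathcal{X}})$. Geodesic segments are minimal (isometric embeddings of real segments). In a uniquely geodesic space $(X,d)$ (every pair of points is joined by a unique geodesic segment), $[x,y]$ is the oriented geodesic segment from $x$ to $y$, and for $0\le t\le 1$, $m_t[x,y]$ is the point of $[x,y]$ dividing it internally at ratio $t:(1-t)$. Write $[x,y]\,||\,[x',y']$ if $d(x,x')=d(y,y')=d(m_{1/2}[x,y],m_{1/2}[x',y'])$. Assumptions on $\mathcal{X}$ (a condition on spaces is required for every $X\in\mathcal{X}$): - $(\mathrm{S}_{+})$: for $(X,d)\in\mathcal{X}$ and $r\geq 1$, $(X,rd)\in\mathcal{X}$. - $(\mathrm{U})$: there is a non-principal ultrafilter $\mathcal{U}$ on $\mathbb{N}$ such that for all $X_n\in\mathcal{X}$ and $w_n\in X_n$ ($n\in\mathbb{N}$), the pointed metric ultraproduct $\lim_{\mathcal{U}}(X_n,w_n)$ belongs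 to $\mathcal{X}$ (after forgetting the base point). Here $\lim_{\mathcal{U}}(X_n,d_n,w_n)$ is the quotient of $\{(x_n)_n\in\prod X_n:\sup_n d_n(x_n,w_n)<\infty\}$ with semi-metric $\lim_{\mathcal{U}}d_n(x_n,y_n)$ by the relation of being at distance $0$, with base point $[(w_n)_n]$. - $(\Theta\text{-}\mathrm{NPC}1)$: $X$ is uniquely geodesic, and for all geodesic segments $[x,y],[x',y']$ in $X$ and all $0\le t\le 1$, $\Theta(d(m_t[x,y],m_t[x',y']))\le(1-t)\Theta(d(x,x'))+t\,\Theta(d(y,y'))$. - $(\mathrm{NPC}2)$: if $[x,y]\,||\,[x',y']$, then $[x,x']\,||\,[y,y']$. - $(\mathrm{NPC}3)$: if $[x,y]\,||\,[y,z]$, then the concatenation $[x,y]\cup[y,z]$ is a geodesic. - $(\mathrm{TP})$: if $[x,y]\,||\,[x',y']$ and $[x',y']\,||\,[x'',y'']$, then $[x,y]\,||\,[x'',y'']$. The $(\mathrm{Game}_l^{+})$ for $(M_1,\ldots,M_l,\Pi)$: a one-player game with $M_1,\ldots,M_l,\Pi$ fixed and subgroups $H_1,\ldots,H_l\leqslant G$ varying stage by stage. Initially $H_i=M_i$ for all $i$. At each stage the player may perform one of the following moves. - Type $(\mathrm{I}_{\tau,l}^{+})$ move, for a permutation $\tau\in\mathrm{Sym}(l)$ of $\{1,\dots,l\}$ having at least one fixed point: pick $P\subseteq G$ such that $hH_ih^{-1}\geqslant M_{\tau(i)}$ for all $h\in P$ and all $1\le i\le l$. Then replace $H_i$ by $\langle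 H_i,P\rangle$ for every $i$ with $\tau(i)=i$, and keep $H_j$ for all other indices $j$. - Type $(\mathrm{II}_{\sigma,l})$ move, for $\sigma\in\mathrm{Sym}(l)$: pick $\Lambda\subseteq\mathrm{Inn}(G)\cdot\Pi$ such that $H_i\geqslant\phi(M_{\sigma(i)})$ for all $\phi\in\Lambda$ and all $1\le i\le l$. Then simultaneously replace each $H_i$, $1\le i\le l$, by $\langle H_i,\bigcup_{\phi\in\Lambda}\phi(H_{\sigma(i)})\rangle$. The player wins if after finitely many moves $H_i=G$ for some $i$. The $(\mathrm{Game}_l)$ is defined in the same way, except that in each type $(\mathrm{I})$ move one additionally requires that the abelianization $Q^{\mathrm{abel}}$ of $Q:=\langle P\rangle$ is a torsion group. *)

(* Defs.v *)
From HB Require Import structures.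
From mathcomp Require Import all_boot all_order all_algebra perm generic_quotient.
From mathcomp Require Import all_classical all_reals all_analysis.
From Stdlib Require Import Relation_Operators.

Set Implicit Arguments.
Unset Strict Implicit.
Unset Printing Implicit Defensive.

Import Order.TTheory GRing.Theory Num.Theory.
Import numFieldNormedType.Exports.

Local Open Scope classical_set_scope.
Local Open Scope ring_scope.
Local Open Scope quotient_scope.

Section Geodesics.
Context {R : realType}.
Implicit Type X : metricType R.

(* The library's [completeType] carries a distinguished point, which metric
   spaces here do not. *)
Definition metric_complete X :=
  forall F : set_system X, ProperFilter F -> cauchy F -> exists x : X, F --> x.

Definition isometric X (Y : metricType R) := exists2 f : X -> Y,
  bijective f & forall x y, mdist (f x) (f y) = mdist x y.

(* Paths are total functions on [R]; only their values on [0, L] matter. *)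
Definition geodesic X (L : R) (c : R -> X) :=
  forall s t, 0 <= s <= L -> 0 <= t <= L -> mdist (c s) (c t) = `|s - t|.

Definition geodesic_between X (x y : X) (c : R -> X) :=
  [/\ geodesic (mdist x y) c, c 0 = x & c (mdist x y) = y].

Definition geodesic_space X :=
  forall x y : X, exists c, geodesic_between x y c.

Definition uniquely_geodesic X :=
  geodesic_space X /\
  forall (x y : X) c c', geodesic_between x y c -> geodesic_between x y c' ->
    forall s, 0 <= s <= mdist x y -> c s = c' s.

(* m_t[x,y]; the default value x is irrelevant in a uniquely geodesic space. *)
Definition geo_pt X (t : R) (x y : X) : X :=
  xget x [set z | exists2 c, geodesic_between x y c & z = c (t * mdist x y)].

(* [x,y] || [x',y'] *)
Definition parallel X (x y x' y' : X) :=
  mdist x x' = mdist y y' /\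
  mdist y y' = mdist (geo_pt 2^-1 x y) (geo_pt 2^-1 x' y').

Definition concat_path X (L : R) (c1 c2 : R -> X) : R -> X :=
  fun s => if s <= L then c1 s else c2 (s - L).

Definition increasing_continuous (Theta : R -> R) :=
  [/\ forall s, 0 <= s -> 0 <= Theta s,
      forall s t, 0 <= s -> s < t -> Theta s < Theta t &
      {within [set s | 0 <= s], continuous Theta}].

Definition NPC1 (Theta : R -> R) X :=
  uniquely_geodesic X /\
  forall (x y x' y' : X) (t : R), 0 <= t <= 1 ->
    Theta (mdist (geo_pt t x y) (geo_pt t x' y')) <=
    (1 - t) * Theta (mdist x x') + t * Theta (mdist y y').

Definition NPC2 X :=
  forall x y x' y' : X, parallel x y x' y' -> parallel x x' y y'.

Definition NPC3 X :=
  forall x y z : X, parallel x y y z ->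
  forall c1 c2, geodesic_between x y c1 -> geodesic_between y z c2 ->
    geodesic (mdist x y + mdist y z) (concat_path (mdist x y) c1 c2).

Definition TP X :=
  forall x y x' y' x'' y'' : X,
    parallel x y x' y' -> parallel x' y' x'' y'' -> parallel x y x'' y''.

(* A Banach space is regarded as a metric space; complex Banach spaces are
   covered by restriction of scalars. *)
Definition banach_space X :=
  exists (E : completeNormedModType R) (f : E -> X),
    bijective f /\ forall u v, mdist (f u) (f v) = `|u - v|.

Definition plane_dist (a b : R * R) : R :=
  Num.sqrt ((a.1 - b.1) ^+ 2 + (a.2 - b.2) ^+ 2).

Definition plane_seg (u : R) (a b : R * R) : R * R :=
  ((1 - u) * a.1 + u * b.1, (1 - u) * a.2 + u * b.2).

(* The CAT(0) inequality for points c1 (u d(p,q)) and c2 (v d(p,r)) on two sides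
   of the geodesic triangle pqr. Relabelling the vertices covers every pair of
   distinct sides; for two points on one side the inequality is an equality. *)
Definition CAT0 X :=
  geodesic_space X /\
  forall (p q r : X) (c1 c2 c3 : R -> X),
    geodesic_between p q c1 -> geodesic_between p r c2 ->
    geodesic_between q r c3 ->
  forall p' q' r' : R * R,
    plane_dist p' q' = mdist p q -> plane_dist p' r' = mdist p r ->
    plane_dist q' r' = mdist q r ->
  forall u v, 0 <= u <= 1 -> 0 <= v <= 1 ->
    mdist (c1 (u * mdist p q)) (c2 (v * mdist p r)) <=
    plane_dist (plane_seg u p' q') (plane_seg v p' r').

End Geodesics.

Section Rescale.
Context {R : realType} (X : metricType R) (r : R) (r1 : 1 <= r).

Definition rescale : Type := let _ := r1 in X.
HB.instance Definition _ := Choice.on rescale.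

Let sdist (x y : rescale) : R := r * mdist (x : X) (y : X).

Let sdistxx x : sdist x x = 0.
Proof. by rewrite /sdist mdistxx mulr0. Qed.

Let sdist_pos x y : sdist x y = 0 -> x = y.
Proof.
move=> /eqP; rewrite mulf_eq0 gt_eqF ?(lt_le_trans _ r1)//= => /eqP.
exact: mdist_positivity.
Qed.

Let sdist_sym x y : sdist x y = sdist y x.
Proof. by rewrite /sdist metric_sym. Qed.

Let sdist_triangle y x z : sdist x z <= sdist x y + sdist y z.
Proof.
by rewrite /sdist -mulrDr ler_wpM2l ?metric_triangle// (le_trans _ r1).
Qed.

HB.instance Definition _ := @isMetric.Build R rescale sdist
  sdistxx sdist_pos sdist_sym sdist_triangle.

End Rescale.

Section Ultraproduct.
Context {R : realType} (U : set_system nat) (UU : UltraFilter U).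
Context (X : nat -> metricType R) (w : forall n, X n).

Definition bounded_seq :=
  {x : forall n, X n | exists C : R, forall n, mdist (x n) (w n) <= C}.

(* [UU] is a phantom argument, so that the instances below can be inferred. *)
Definition useq : Type := let _ := UU in {classic bounded_seq}.
HB.instance Definition _ := Choice.on useq.

Definition udist (x y : useq) : R :=
  lim (mdist (sval x n) (sval y n) @[n --> U]).

Lemma udist_cvg (x y : useq) :
  mdist (sval x n) (sval y n) @[n --> U] --> udist x y.
Proof.
set f := fun n => _.
suff [p fp] : exists p : R, f @ U --> p by rewrite /udist (cvg_lim _ fp).
case: x y @f => [x [C xC]] [y [D yD]] f.
have fCD n : 0 <= f n <= C + D.
  rewrite mdist_ge0/= (le_trans (metric_triangle _ (w n) _))// lerD//.
  by rewrite metric_sym.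
have [p [_ clp]] : `[0, C + D] `&` cluster (f @ U) !=set0.
  apply: (@segment_compact R 0 (C + D) (f @ U)).
  apply: (@filterS _ U _ setT); last exact: filterT.
  by move=> n _ /=; rewrite in_itv/= fCD.
exists p => V pV.
have [//|UnV] := in_ultra_setVsetC (f @^-1` V) UU.
have [] := clp (~` V) V UnV pV.
by move=> ? [].
Qed.

Lemma udist_eq (x y : useq) l :
  mdist (sval x n) (sval y n) @[n --> U] --> l -> udist x y = l.
Proof. exact: cvg_lim. Qed.

Lemma udistxx x : udist x x = 0.
Proof.
apply: udist_eq; under eq_fun do rewrite mdistxx; exact: cvg_cst.
Qed.

Lemma udist_sym x y : udist x y = udist y x.
Proof.
apply: udist_eq; under eq_fun do rewrite metric_sym; exact: udist_cvg.
Qed.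

Lemma udist_triangle y x z : udist x z <= udist x y + udist y z.
Proof.
apply: (ler_cvg_to (@udist_cvg x z) (cvgD (@udist_cvg x y) (@udist_cvg y z))).
by apply: nearW => n; exact: metric_triangle.
Qed.

Lemma udist_ge0 x y : 0 <= udist x y.
Proof.
rewrite -(udistxx x); apply: (ler_cvg_to (@udist_cvg x x) (@udist_cvg x y)).
by apply: nearW => n; rewrite mdistxx mdist_ge0.
Qed.

Definition useq_eqv : rel useq := [rel x y | udist x y == 0].

Lemma useq_eqv_equiv : equiv_class_of useq_eqv.
Proof.
split=> [x|x y|y x z]; rewrite /useq_eqv/= ?udistxx//; first by rewrite udist_sym.
move=> /eqP xy /eqP yz; rewrite eq_le udist_ge0 andbT.
by rewrite (le_trans (udist_triangle y _ _))// xy yz addr0.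
Qed.

Canonical useq_eqv_rel := EquivRelPack useq_eqv_equiv.

Definition ultraproduct : Type := {eq_quot useq_eqv}.
HB.instance Definition _ := Choice.on ultraproduct.
HB.instance Definition _ := EqQuotient.on ultraproduct.

Definition uprod_dist (a b : ultraproduct) : R := udist (repr a) (repr b).

Lemma uprod_distE (x y : useq) :
  uprod_dist (\pi_ultraproduct x) (\pi_ultraproduct y) = udist x y.
Proof.
have H (z : useq) : udist z (repr (\pi_ultraproduct z)) = 0.
  by apply/eqP/(@eqquotP _ _ ultraproduct); rewrite reprK.
rewrite /uprod_dist; apply/eqP; rewrite eq_le; apply/andP; split.
  rewrite (le_trans (udist_triangle x _ _))// udist_sym H add0r.
  by rewrite (le_trans (udist_triangle y _ _))// H addr0.
rewrite (le_trans (udist_triangle (repr (\pi_ultraproduct x)) _ _))// H add0r.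
rewrite (le_trans (udist_triangle (repr (\pi_ultraproduct y)) _ _))//.
by rewrite (udist_sym (repr (\pi y))) H addr0.
Qed.

Let uprod_distxx a : uprod_dist a a = 0.
Proof. exact: udistxx. Qed.

Let uprod_dist_pos a b : uprod_dist a b = 0 -> a = b.
Proof. by move=> /eqP ab; rewrite -[a]reprK -[b]reprK; apply/(@eqquotP _ _ ultraproduct). Qed.

Let uprod_dist_sym a b : uprod_dist a b = uprod_dist b a.
Proof. exact: udist_sym. Qed.

Let uprod_dist_triangle b a c :
  uprod_dist a c <= uprod_dist a b + uprod_dist b c.
Proof. exact: udist_triangle. Qed.

HB.instance Definition _ := @isMetric.Build R ultraproduct uprod_dist
  uprod_distxx uprod_dist_pos uprod_dist_sym uprod_dist_triangle.

End Ultraproduct.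

Section Classes.
Context {R : realType} (XX : metricType R -> Prop).

(* A class of metric spaces is understood up to isometry. *)
Definition in_class (Y : metricType R) := exists2 X, XX X & isometric X Y.

Definition S_plus :=
  forall X, XX X -> forall (r : R) (r1 : 1 <= r), in_class (rescale X r1).

Definition U_closed :=
  exists (U : set_system nat) (UU : UltraFilter U),
    (forall n : nat, ~ U [set n]) /\
    forall (X : nat -> metricType R) (w : forall n, X n),
      (forall n, XX (X n)) -> in_class (ultraproduct UU w).

End Classes.

Section Groups.
Context {G : groupType}.
Implicit Types (H Q A : set G) (Pi : set (G -> G)).
Local Open Scope group_scope.

Definition subgroup H :=
  [/\ H 1, forall x y, H x -> H y -> H (x * y) & forall x, H x -> H x^-1].

Definition gen A : set G := smallest subgroup A.

Definition fin_gen := exists2 A : set G, finite_set A & gen A = setT.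

Definition automorphism (f : G -> G) :=
  bijective f /\ {morph f : x y / x * y}.

Definition aut_subgroup Pi :=
  [/\ Pi `<=` automorphism, Pi id,
      forall f g, Pi f -> Pi g -> Pi (f \o g) &
      forall f g, Pi f -> cancel f g -> cancel g f -> Pi g].

Definition conj_by (h x : G) : G := h * x * h^-1.

(* Inn(G) . Pi *)
Definition inn_mul Pi : set (G -> G) :=
  [set f | exists g, exists2 p, Pi p & f = conj_by g \o p].

Definition derived Q : set G :=
  gen [set z | exists x y, [/\ Q x, Q y & z = [~ x, y]]].

(* Q / [Q, Q] is a torsion group *)
Definition torsion_abelianization Q :=
  forall q, Q q -> exists2 n, (0 < n)%N & derived Q (q ^+ n).

Definition isometric_action (R : realType) (X : metricType R)
    (a : G -> X -> X) :=
  [/\ forall x, a 1 x = x,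
      forall g h x, a (g * h) x = a g (a h x) &
      forall g x y, mdist (a g x) (a g y) = mdist x y].

Definition fixed_points (X : Type) (a : G -> X -> X) H : set X :=
  [set x | forall h, H h -> a h x = x].

Definition relative_F (R : realType) (XX : metricType R -> Prop) H :=
  forall X, XX X -> forall a : G -> X -> X, isometric_action a ->
    fixed_points a H !=set0.

Definition property_F (R : realType) (XX : metricType R -> Prop) :=
  relative_F XX setT.

Section Game.
Context {l : nat}.
(* [adm] is the extra requirement put on the set P picked in a type (I) move. *)
Context (adm : set G -> Prop) (M : 'I_l -> set G) (Pi : set (G -> G)).

Definition move_I (H H' : 'I_l -> set G) :=
  exists (tau : {perm 'I_l}) (P : set G),
    [/\ exists i, tau i = i,
        adm P,
        forall h i, P h -> M (tau i) `<=` conj_by h @` H i &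
        forall i, H' i = if tau i == i then gen (H i `|` P) else H i].

Definition move_II (H H' : 'I_l -> set G) :=
  exists (sigma : {perm 'I_l}) (Lambda : set (G -> G)),
    [/\ Lambda `<=` inn_mul Pi,
        forall phi i, Lambda phi -> phi @` M (sigma i) `<=` H i &
        forall i, H' i =
          gen (H i `|` \bigcup_(phi in Lambda) phi @` H (sigma i))].

Definition game_move (H H' : 'I_l -> set G) := move_I H H' \/ move_II H H'.

(* There is a single player, so a winning strategy is a finite sequence of
   moves leading to a winning position. *)
Definition winning_strategy :=
  exists2 H, clos_refl_trans _ game_move M H & exists i, H i = setT.

End Game.

Definition Game_plus l (M : 'I_l -> set G) Pi :=
  winning_strategy (fun=> True) M Pi.

Definition Game l (M : 'I_l -> set G) Pi :=
  winning_strategy (fun P => torsion_abelianization (gen P)) M Pi.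

End Groups.

Arguments fin_gen : clear implicits.
Arguments property_F G {R} XX.

(* Main.v *)
Require Import Defs.
From mathcomp Require Import all_boot all_order all_algebra perm.
From mathcomp Require Import all_classical all_reals all_analysis.
From mathcomp Require Import ring lra.

(** Suppose that some action of [G] on a space of the class has no fixed point.

    A rescaling argument of Gromov and Schoen, followed by an ultraproduct,
    yields an action whose displacement under a finite generating set is
    everywhere at least one half ([uniform_action_exists]). Among all such
    actions and all tuples [x] of points [x i] fixed by [M i], a further
    ultraproduct minimizes the energy, which is the sum over [i] and [j] of
    [Theta (d (x i, x j)) ^ 2] ([minimal_configuration_exists]). By convexity, two
    minimal tuples [x], [y] for the same action differ by parallel segments
    [[x i, y i]] ([minimal_parallel]). As the segment of index [j] is fixed by
    [M j] and the [M j] generate [G], the direction of these segments is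
    invariant under [G].

    At every stage of the game, [H i] fixes [x i] for every minimal tuple [x] of
    every such action. A move of type II preserves this property because a
    minimal tuple, relabelled by [sigma], is also minimal for the action twisted
    by [phi] ([move_II_minimal_fixed]); the twisted action still satisfies the
    lower bound on the displacement, as the generating set is chosen invariant
    under the finite group [Pi]. In a move of type I, an element [h] of [P] sends [x] to
    another minimal tuple up to the permutation [tau], so at an index [i] fixed
    by [tau] the displacement of [h] from [x i] to [h (x i)] has an invariant
    direction: [h] is a translation along the orbit of [x i]
    ([move_I_minimal_fixed]). It remains to see that such a translation fixes
    [x i], for a winning position then gives a point fixed by [G], in
    contradiction with the lower bound on the displacement.

    When the group generated by [P] has torsion abelianization, commutators of
    translations fix [x i], so a power of [h] does, whereas the displacement of
    [h ^ (2 ^ k)] is [2 ^ k] times that of [h] ([translations_fix_torsion]).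

    In the two other cases every translation is trivial. For CAT(0) spaces, a
    nontrivial translation would have an axis whose end is fixed by [G], and the
    Busemann character of this end would be a nonzero homomorphism from [G] to
    the reals that vanishes on each [M i] ([CAT0_translation_trivial]). For Banach
    spaces, the displacement [c] is a vector fixed by the linear part [pi] and,
    since the cocycle of the action is a coboundary on each [M i], it is a finite
    sum of vectors [v - pi g v]. The class being closed under ultraproducts, the
    space is uniformly convex ([uniform_convexity]). A nonzero such [c] would be
    the linear drift of a random walk of affine isometries with centred steps,
    whereas in a uniformly convex space the independence of the steps forces
    their partial sums to grow sublinearly ([invariant_coinvariant_eq0]). *)

Set Implicit Arguments.
Unset Strict Implicit.
Unset Printing Implicit Defensive.
Import Order.TTheory GRing.Theory Num.Theory.
Import numFieldNormedType.Exports.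
Local Open Scope classical_set_scope.
Local Open Scope ring_scope.

(** * Geodesics, midpoints and parallel segments *)

Section Geodesics.
Context {R : realType}.
Implicit Types X Y : metricType R.

Lemma geodesic_between_isometry X Y (f : X -> Y) x y c :
  (forall u v, mdist (f u) (f v) = mdist u v) ->
  geodesic_between x y c -> geodesic_between (f x) (f y) (f \o c).
Proof.
move=> fd [cg c0 c1]; split=> /=; rewrite ?fd ?c0 ?c1//.
by move=> s t sL tL /=; rewrite fd cg.
Qed.

Lemma geo_ptE X (x y : X) c (t : R) : uniquely_geodesic X ->
  geodesic_between x y c -> 0 <= t <= 1 -> geo_pt t x y = c (t * mdist x y).
Proof.
move=> [_ uX] cxy /andP[t0 t1]; rewrite /geo_pt.
case: xgetP => [z _ [c' c'xy ->]|/(_ (c (t * mdist x y)))[]]; last by exists c.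
apply: uX c'xy cxy _ _.
by rewrite mulr_ge0 ?mdist_ge0//= ler_piMl ?mdist_ge0.
Qed.

Lemma mdist_geo_ptl X (x y : X) (t : R) : uniquely_geodesic X ->
  0 <= t <= 1 -> mdist x (geo_pt t x y) = t * mdist x y.
Proof.
move=> uX t01; have [c cxy] := uX.1 x y; rewrite (geo_ptE uX cxy t01).
case: cxy => cg c0 _; case/andP: t01 => t0 t1.
have tL : 0 <= t * mdist x y <= mdist x y.
  by rewrite mulr_ge0 ?mdist_ge0//= ler_piMl ?mdist_ge0.
by rewrite -{1}c0 cg ?lexx ?mdist_ge0// sub0r normrN ger0_norm//; case/andP: tL.
Qed.

Lemma geo_ptxx X (x : X) (t : R) : uniquely_geodesic X ->
  0 <= t <= 1 -> geo_pt t x x = x.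
Proof.
by move=> uX t01; apply/esym/mdist_positivity; rewrite mdist_geo_ptl// mdistxx mulr0.
Qed.

Lemma geo_pt_isometry X Y (f : X -> Y) x y (t : R) :
  uniquely_geodesic X -> uniquely_geodesic Y ->
  (forall u v, mdist (f u) (f v) = mdist u v) -> 0 <= t <= 1 ->
  f (geo_pt t x y) = geo_pt t (f x) (f y).
Proof.
move=> uX uY fd t01; have [c cxy] := uX.1 x y.
rewrite (geo_ptE uX cxy t01).
by rewrite (geo_ptE uY (geodesic_between_isometry fd cxy) t01) fd.
Qed.

(** Two geodesics that add up to the distance of their outer ends concatenate
    to a geodesic, so uniqueness of geodesics pins down the midpoint by its two
    distances. *)
Lemma midpoint_unique X (x y z : X) : uniquely_geodesic X ->
  mdist x z = mdist x y / 2 -> mdist z y = mdist x y / 2 ->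
  z = geo_pt 2^-1 x y.
Proof.
move=> uX xz zy; have h01 : 0 <= (2^-1 : R) <= 1 by apply/andP; split; lra.
have [d0|dn0] := eqVneq (mdist x y) 0.
  have xy := mdist_positivity _ _ d0; rewrite -xy geo_ptxx//.
  by apply/esym/mdist_positivity; rewrite xz d0 mul0r.
have d0 : 0 < mdist x y by rewrite lt_def dn0 mdist_ge0.
have [c1 [g1 c10 c11]] := uX.1 x z; have [c2 [g2 c20 c21]] := uX.1 z y.
rewrite xz in g1 c11; rewrite zy in g2 c21.
set d := mdist x y in xz zy d0 g1 g2 c11 c21 *.
have lo s : 0 <= s -> s <= d / 2 -> mdist (c1 s) z = d / 2 - s.
  by move=> s0 sd; rewrite -c11 g1 ?s0 ?sd ?lexx ?andbT//=; [rewrite ler0_norm; lra|lra].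
have lo0 s : 0 <= s -> s <= d / 2 -> mdist x (c1 s) = s.
  move=> s0 sd; rewrite -c10 g1 ?s0 ?sd ?lexx//=; [|lra].
  by rewrite sub0r normrN ger0_norm.
have hi s : 0 <= s -> s <= d / 2 -> mdist z (c2 s) = s.
  move=> s0 sd; rewrite -c20 g2 ?s0 ?sd ?lexx//=; [|lra].
  by rewrite sub0r normrN ger0_norm.
have hi1 s : 0 <= s -> s <= d / 2 -> mdist (c2 s) y = d / 2 - s.
  by move=> s0 sd; rewrite -c21 g2 ?s0 ?sd ?lexx ?andbT//=; [rewrite ler0_norm; lra|lra].
have mid s t : 0 <= s -> s <= d / 2 -> 0 <= t -> t <= d / 2 ->
    mdist (c1 s) (c2 t) = d / 2 - s + t.
  move=> s0 sd t0 td; apply/eqP; rewrite eq_le; apply/andP; split.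
    by rewrite (le_trans (metric_triangle _ z _))// lo// hi.
  have := metric_triangle x (c1 s) y; have := metric_triangle (c1 s) (c2 t) y.
  rewrite lo0// hi1// -/d; lra.
have cxy : geodesic_between x y (concat_path (d / 2) c1 c2).
  split; rewrite /concat_path -/d; last 2 first.
  - by rewrite ifT//; lra.
  - rewrite ifF; last by apply/negbTE; rewrite -ltNge; lra.
    by have -> : d - d / 2 = d / 2 by lra.
  move=> s t /andP[s0 sd] /andP[t0 td].
  case: (leP s (d / 2)) => sm; case: (leP t (d / 2)) => tm.
  - by rewrite g1 ?s0 ?t0.
  - rewrite mid//; [|lra..]; rewrite ler0_norm; lra.
  - rewrite metric_sym mid//; [|lra..]; rewrite ger0_norm; lra.
  - rewrite g2; last 2 first; [by apply/andP; split; lra..|].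
    by congr (`|_|); lra.
rewrite (geo_ptE uX cxy h01) /concat_path ifT -/d; last lra.
by rewrite mulrC c11.
Qed.

Lemma parallel_sym X (x y x' y' : X) : parallel x y x' y' -> parallel x' y' x y.
Proof.
rewrite /parallel => -[h1 h2].
by rewrite !(metric_sym x') !(metric_sym y') !(metric_sym (geo_pt _ x' y')).
Qed.

Lemma parallel_refl X (x y : X) : parallel x y x y.
Proof. by split; rewrite !mdistxx. Qed.

Lemma parallel_isometry X (f : X -> X) x y x' y' : uniquely_geodesic X ->
  (forall u v, mdist (f u) (f v) = mdist u v) ->
  parallel x y x' y' -> parallel (f x) (f y) (f x') (f y').
Proof.
move=> uX fd [h1 h2].
have h01 : 0 <= (2^-1 : R) <= 1 by apply/andP; split; lra.
by split; rewrite -?(geo_pt_isometry _ _ uX uX fd h01) !fd.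
Qed.

Lemma NPC3_mdist X (x y z : X) : geodesic_space X -> NPC3 X ->
  parallel x y y z -> mdist x z = mdist x y + mdist y z.
Proof.
move=> gX /[apply] cat; have [c1 g1] := gX x y; have [c2 g2] := gX y z.
have := cat c1 c2 g1 g2 0 (mdist x y + mdist y z).
case: g1 => _ c10 c11; case: g2 => _ c20 c21.
have d1 := mdist_ge0 x y; have d2 := mdist_ge0 y z.
rewrite !lexx !addr_ge0// => /(_ isT isT).
rewrite /concat_path d1 c10 sub0r normrN ger0_norm ?addr_ge0//.
case: ifP => [|_]; last by rewrite addrAC subrr add0r c21.
rewrite gerDl => d20; have {d20}d2 : mdist y z = 0 by apply/eqP; rewrite eq_le d20.
by rewrite d2 addr0 c11 (mdist_positivity _ _ d2).
Qed.

Section Vectors.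
Context (X : metricType R) (X2 : NPC2 X) (XT : TP X).

Lemma parallel_rev (x y x' y' : X) : parallel x y x' y' -> parallel y x y' x'.
Proof. by move=> /X2/parallel_sym/X2. Qed.

Lemma parallel_add (x y z x' y' z' : X) : parallel x y x' y' ->
  parallel y z y' z' -> parallel x z x' z'.
Proof. by move=> /X2 xy /X2 yz; apply/X2/(XT xy yz). Qed.

Lemma parallel_degenerate (x x' : X) : parallel x x x' x'.
Proof. exact/X2/parallel_refl. Qed.

Lemma parallel_eq (x y y' : X) : parallel x y x y' -> y = y'.
Proof. by case; rewrite mdistxx => /esym/mdist_positivity. Qed.

End Vectors.
End Geodesics.

(** * Translations along an orbit *)

Section Actions.
Context {R : realType} {G : groupType} {X : metricType R}.
Implicit Types (a : G -> X -> X) (A B : set G).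

Lemma gen_subgroup A : subgroup (gen A).
Proof.
split=> [B [[]]//|x y Ax Ay B BA|x Ax B BA].
- by case: BA.1 => _ M _; apply: M; [exact: Ax|exact: Ay].
- by case: BA.1 => _ _ V; apply: V; exact: Ax.
Qed.

Lemma sub_gen A : A `<=` gen A.
Proof. exact: sub_gen_smallest. Qed.

Lemma gen_sub A B : subgroup B -> A `<=` B -> gen A `<=` B.
Proof. exact: smallest_sub. Qed.

Lemma actVK a g x : isometric_action a -> a g^-1%g (a g x) = x.
Proof. by move=> [a1 aM _]; rewrite -aM mulVg a1. Qed.

Lemma actKV a g x : isometric_action a -> a g (a g^-1%g x) = x.
Proof. by move=> [a1 aM _]; rewrite -aM mulgV a1. Qed.

Lemma stabilizer_subgroup a x : isometric_action a ->
  subgroup [set g | a g x = x].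
Proof.
move=> aA; have [a1 aM _] := aA; split=> //= [g h gx hx|g gx].
  by rewrite aM hx gx.
by rewrite -{1}gx actVK.
Qed.

Lemma act_dist a g x y : isometric_action a -> mdist (a g x) (a g y) = mdist x y.
Proof. by case. Qed.

Lemma mdist_act1 a g x y : isometric_action a ->
  mdist x (a g x) <= mdist y (a g y) + 2 * mdist x y.
Proof.
move=> aA; have := metric_triangle x y (a g x).
have := metric_triangle y (a g y) (a g x).
by rewrite (act_dist _ _ _ aA) (metric_sym y x); lra.
Qed.

(** For an affine action on a Banach space these are the [q] whose displacement
    [q x - x] is fixed by the linear part of the action. *)
Definition translation_at a (x : X) : set G :=
  [set q | forall g, parallel x (a q x) (a g x) (a g (a q x))].

Section Translations.
Context (uX : uniquely_geodesic X) (X2 : NPC2 X) (X3 : NPC3 X) (XT : TP X).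
Context (a : G -> X -> X) (aA : isometric_action a) (x : X).

Let aM g h y : a (g * h)%g y = a g (a h y). Proof. by case: aA. Qed.
Let a1 y : a 1%g y = y. Proof. by case: aA. Qed.

Lemma parallel_act g (y z y' z' : X) :
  parallel y z y' z' -> parallel (a g y) (a g z) (a g y') (a g z').
Proof. by apply: parallel_isometry => // u v; exact: act_dist. Qed.

Lemma parallel_invariant_subgroup (y z : X) :
  subgroup [set g | parallel y z (a g y) (a g z)].
Proof.
split=> /= [|g h gP hP|g gP]; first by rewrite !a1; exact: parallel_refl.
  by rewrite !aM; exact: XT gP (parallel_act g hP).
have := parallel_act g^-1%g gP; rewrite !actVK//.
exact: parallel_sym.
Qed.

Lemma translation_subgroup : subgroup (translation_at a x).
Proof.
split=> [g|q r qT rT g|q qT g].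
- by rewrite a1; exact: parallel_degenerate.
- rewrite aM; apply: (parallel_add X2 XT) (qT g) _.
  apply: XT (parallel_sym (rT q)) _.
  by rewrite -[a g (a q x)]aM -[a g (a q (a r x))]aM.
- have h1 := qT q^-1%g; rewrite actVK// in h1.
  have h2 := qT (g * q^-1)%g; rewrite !aM actVK// in h2.
  exact/(parallel_rev X2)/(XT (parallel_sym h1) h2).
Qed.

Lemma translation_expg q n : translation_at a x q ->
  translation_at a x (q ^+ n)%g.
Proof.
have [T1 TM _] := translation_subgroup.
by move=> qT; elim: n => [|n IHn]; [rewrite expg0|rewrite expgS; exact: TM].
Qed.

Lemma translation_double q : translation_at a x q ->
  mdist x (a (q * q)%g x) = 2 * mdist x (a q x).
Proof.
by move=> qT; rewrite aM (NPC3_mdist uX.1 X3 (qT q)) (act_dist _ _ _ aA); lra.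
Qed.

Lemma translation_expg2n q k : translation_at a x q ->
  mdist x (a (q ^+ (2 ^ k))%g x) = 2 ^+ k * mdist x (a q x).
Proof.
move=> qT; elim: k => [|k IHk]; first by rewrite expn0 expg1 expr0 mul1r.
rewrite expnS mulnC expgnA expg2 translation_double; last exact: translation_expg.
by rewrite IHk exprS mulrA.
Qed.

(** Both ways around the parallelogram spanned by two translation vectors lead
    to the same point. *)
Lemma translation_comm q r : translation_at a x q -> translation_at a x r ->
  a (q * r)%g x = a (r * q)%g x.
Proof.
move=> qT rT; rewrite !aM; apply: (@parallel_eq _ _ (a r x)).
exact: XT (parallel_sym (X2 (rT q))) (qT r).
Qed.

(** The displacement vectors of translations add up like vectors, so every
    commutator of translations has displacement zero. *)
Lemma translation_derived (Q : set G) : Q `<=` translation_at a x ->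
  forall g, derived Q g -> a g x = x.
Proof.
move=> QT; apply: gen_sub; first exact: stabilizer_subgroup.
move=> _ [q [r [Qq Qr ->]]] /=.
rewrite /commg /conjg aM [a (r^-1 * _)%g x]aM.
by rewrite (translation_comm (QT _ Qq) (QT _ Qr)) aM !actVK.
Qed.

(** A translation of finite order modulo the stabilizer has bounded powers,
    whereas the displacement doubles along its powers of exponent a power
    of two. *)
Lemma translation_torsion q n : translation_at a x q -> (0 < n)%N ->
  a (q ^+ n)%g x = x -> a q x = x.
Proof.
move=> qT n0 qn; set d := mdist x (a q x).
have pow m : mdist x (a (q ^+ m)%g x) <= m%:R * d.
  elim: m => [|m IHm]; first by rewrite expg0 a1 mdistxx mul0r.
  rewrite expgSr aM (le_trans (metric_triangle _ (a (q ^+ m)%g x) _))//.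
  by rewrite (act_dist _ _ _ aA) mulrSr mulrDl mul1r lerD.
have qnm m : a (q ^+ (m * n))%g x = x.
  by elim: m => [|m IHm]; rewrite ?mul0n ?expg0 ?a1// mulSn expgnDr aM IHm.
have bnd m : mdist x (a (q ^+ m)%g x) <= n%:R * d.
  rewrite (divn_eq m n) addnC expgnDr aM qnm (le_trans (pow _))//.
  by rewrite ler_wpM2r ?mdist_ge0// ler_nat ltnW// ltn_mod.
have := bnd (2 ^ n)%N; rewrite translation_expg2n// -/d -natrX => h.
apply/esym/mdist_positivity/eqP; rewrite -/d eq_le mdist_ge0 andbT leNgt.
apply/negP => d0; move: h; rewrite ler_pM2r// ler_nat leqNgt.
by rewrite ltn_expl.
Qed.

Lemma translations_fix_torsion (P : set G) : torsion_abelianization (gen P) ->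
  gen P `<=` translation_at a x -> forall q, P q -> a q x = x.
Proof.
move=> Ptor PT q Pq; have [n n0 qn] := Ptor q (sub_gen Pq).
apply: (translation_torsion _ n0); first exact: PT (sub_gen Pq).
exact: translation_derived qn.
Qed.

End Translations.
End Actions.

(** * CAT(0) spaces: the Busemann character *)

Section CAT0Rigidity.
Context {R : realType}.

Lemma pow2_bounded_eq0 (d C : R) : 0 <= d -> (forall k, 2 ^+ k * d <= C) -> d = 0.
Proof.
move=> d0 dC; apply/eqP; rewrite eq_le d0 andbT leNgt; apply/negP => dp.
have C0 : 0 <= C / d.
  by rewrite divr_ge0// (le_trans _ (dC 0%N))// expr0 mul1r.
have := dC (Num.bound (C / d)); rewrite -ler_pdivlMr// leNgt => /negP; apply.
rewrite (lt_le_trans (archi_boundP C0))// -natrX ler_nat.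
exact/ltnW/ltn_expl.
Qed.

Context {X : metricType R} (catX : CAT0 X) (uX : uniquely_geodesic X).

Lemma plane_comparison (a b e : R) : 0 < a -> 0 <= b -> 0 <= e ->
  a <= b + e -> b <= a + e -> e <= a + b ->
  exists p q r : R * R, [/\ plane_dist p q = a, plane_dist p r = b,
    plane_dist q r = e &
    plane_dist (plane_seg 2^-1 p q) r ^+ 2 = (b ^+ 2 + e ^+ 2) / 2 - a ^+ 2 / 4].
Proof.
move=> a0 b0 e0 abe bae eab.
pose s := (a ^+ 2 + b ^+ 2 - e ^+ 2) / (2 * a).
pose t := Num.sqrt (b ^+ 2 - s ^+ 2).
have as2 : 2 * a * s = a ^+ 2 + b ^+ 2 - e ^+ 2.
  by rewrite /s mulrC divfK//; lra.
have t2 : t ^+ 2 = b ^+ 2 - s ^+ 2.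
  rewrite sqr_sqrtr// subr_ge0 -[leRHS]ger0_norm ?sqr_ge0//.
  rewrite -[leLHS]ger0_norm ?sqr_ge0// !normrX lerXn2r ?nnegrE//.
  rewrite (ger0_norm b0) ler_norml; apply/andP; split.
    by rewrite -(ler_pM2l (_ : 0 < 2 * a))//; [rewrite as2; nra|lra].
  by rewrite -(ler_pM2l (_ : 0 < 2 * a))//; [rewrite as2; nra|lra].
exists (0, 0), (a, 0), (s, t); rewrite /plane_dist /plane_seg /=; split.
- by rewrite !sub0r oppr0 expr0n /= addr0 sqrrN sqrtr_sqr gtr0_norm.
- by rewrite !sub0r !sqrrN t2 addrC subrK sqrtr_sqr ger0_norm.
- rewrite sub0r sqrrN t2.
  have -> : (a - s) ^+ 2 + (b ^+ 2 - s ^+ 2) = e ^+ 2 by nra.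
  by rewrite sqrtr_sqr ger0_norm.
- rewrite sqr_sqrtr ?addr_ge0 ?sqr_ge0// !mulr0 !addr0 add0r sub0r sqrrN t2.
  nra.
Qed.

(** The comparison triangle has the midpoint of one side at the distance from
    the opposite vertex given by the median formula. *)
Lemma CN_inequality (x q y : X) : mdist (geo_pt 2^-1 x q) y ^+ 2 <=
  (mdist x y ^+ 2 + mdist q y ^+ 2) / 2 - mdist x q ^+ 2 / 4.
Proof.
have h01 : 0 <= (2^-1 : R) <= 1 by apply/andP; split; lra.
have [xq|xq] := eqVneq x q; first by rewrite xq geo_ptxx// mdistxx; lra.
have a0 : 0 < mdist x q by rewrite mdist_gt0.
have t1 := metric_triangle x y q; have t2 := metric_triangle x q y.
have t3 := metric_triangle q x y; rewrite (metric_sym y) in t1.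
rewrite (metric_sym q x) in t3.
have [p' [q' [r' [d1 d2 d3 <-]]]] :=
  plane_comparison a0 (mdist_ge0 x y) (mdist_ge0 q y) t1 t2 t3.
have [c1 g1] := uX.1 x q; have [c2 g2] := uX.1 x y; have [c3 g3] := uX.1 q y.
have := catX.2 x q y c1 c2 c3 g1 g2 g3 p' q' r' d1 d2 d3 2^-1 1 h01.
rewrite lexx ler01 => /(_ isT); rewrite -(geo_ptE uX g1 h01) mul1r.
case: g2 => _ _ ->.
have -> : plane_seg 1 p' r' = r'.
  by case: (r') => r1 r2; rewrite /plane_seg /= subrr !mul0r !add0r !mul1r.
by move=> h; rewrite lerXn2r ?nnegrE ?mdist_ge0// sqrtr_ge0.
Qed.

(** Apply the previous inequality to the midpoint of one diagonal, seen from
    both ends of the other. *)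
Lemma quadrilateral_inequality (x y z w : X) :
  mdist x z ^+ 2 + mdist y w ^+ 2 <=
  mdist x y ^+ 2 + mdist y z ^+ 2 + mdist z w ^+ 2 + mdist w x ^+ 2.
Proof.
have h1 := CN_inequality x z y; have h2 := CN_inequality x z w.
set m := geo_pt _ x z in h1 h2.
have h3 := metric_triangle y m w; rewrite (metric_sym y m) in h3.
have d1 := mdist_ge0 m y; have d2 := mdist_ge0 m w.
have h4 : mdist y w ^+ 2 <= (mdist m y + mdist m w) ^+ 2.
  by rewrite lerXn2r ?nnegrE ?mdist_ge0 ?addr_ge0.
have h5 := sqr_ge0 (mdist m y - mdist m w).
rewrite (metric_sym y z) (metric_sym w x); nra.
Qed.

Context {G : groupType} (a : G -> X -> X) (aA : isometric_action a).

(** The Busemann character, without the limit. For a translation [h] of [x],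
    the point [h ^ n x] stays at bounded distance from its image under [g], so
    by the quadrilateral inequality the function below is, up to an error
    bounded in [n], independent of the base point [y]. It is therefore additive
    in [g] up to a bounded error, and it vanishes when [g] fixes [y]. *)
Definition busemann_defect (h : G) (x : X) (n : nat) (g : G) (y : X) : R :=
  mdist y (a g (a (h ^+ n)%g x)) ^+ 2 - mdist y (a (h ^+ n)%g x) ^+ 2.

Context (X2 : NPC2 X) (X3 : NPC3 X) (XT : TP X).

Lemma busemann_defect_basepoint h x n g y z : translation_at a x h ->
  busemann_defect h x n g y <= busemann_defect h x n g z
    + (mdist y z ^+ 2 + mdist x (a g x) ^+ 2).
Proof.
move=> hT; have [-> _] := translation_expg X2 XT aA n hT g.
rewrite /busemann_defect; set u := a (h ^+ n)%g x.
have := quadrilateral_inequality y z (a g u) u.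
by rewrite (metric_sym (a g u)) (metric_sym u y); lra.
Qed.

Lemma busemann_bounded_subgroup h x : translation_at a x h ->
  subgroup [set g | exists C, forall n, `|busemann_defect h x n g x| <= C].
Proof.
move=> hT; have [a1 aM aD] := aA.
have base g y n : `|busemann_defect h x n g y| <=
    `|busemann_defect h x n g x| + (mdist y x ^+ 2 + mdist x (a g x) ^+ 2).
  have := busemann_defect_basepoint n g y x hT.
  have := busemann_defect_basepoint n g x y hT.
  rewrite (metric_sym x y) => h1 h2; rewrite ler_norml; apply/andP.
  have := ler_norm (busemann_defect h x n g x).
  have := ler_norm (- busemann_defect h x n g x); rewrite normrN => h3 h4.
  by split; lra.
split=> /= [|g k [C gC] [D kD]|g [C gC]].
- exists 0 => n; rewrite /busemann_defect a1 subrr normr0; exact: lexx.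
- exists (C + (D + (mdist (a g^-1%g x) x ^+ 2 + mdist x (a k x) ^+ 2))) => n.
  have -> : busemann_defect h x n (g * k)%g x =
      busemann_defect h x n g x + busemann_defect h x n k (a g^-1%g x).
    rewrite /busemann_defect -(aD g (a g^-1%g x)) -(aD g (a g^-1%g x) (a _ x)).
    by rewrite (actKV _ _ aA) aM; lra.
  by rewrite (le_trans (ler_normD _ _))// lerD// (le_trans (base _ _ _))// lerD2r.
- exists (C + (mdist (a g x) x ^+ 2 + mdist x (a g x) ^+ 2)) => n.
  have -> : busemann_defect h x n g^-1%g x = - busemann_defect h x n g (a g x).
    rewrite /busemann_defect -(aD g x) -(aD g x (a _ x)).
    by rewrite (actKV _ _ aA); lra.
  by rewrite normrN (le_trans (base _ _ _))// lerD2r.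
Qed.

(** The defect of [h] itself is bounded in [n], but it is also the increment at
    [n] of the squared displacement of [h ^ n]. Hence this squared displacement
    grows at most linearly, whereas along a nontrivial translation it grows
    quadratically. *)
Lemma CAT0_translation_trivial (I : Type) (M : I -> set G) h x :
  (forall i, fixed_points a (M i) !=set0) -> gen (\bigcup_i M i) = setT ->
  translation_at a x h -> a h x = x.
Proof.
move=> Mfix Mgen hT; have [a1 aM aD] := aA.
have [C hC] : [set g | exists C, forall n, `|busemann_defect h x n g x| <= C] h.
  apply: (@gen_sub _ (\bigcup_i M i)); last by rewrite Mgen.
    exact: busemann_bounded_subgroup.
  move=> m [i _ Mm] /=; have [p /(_ m Mm) mp] := Mfix i.
  exists (mdist x p ^+ 2 + mdist x (a m x) ^+ 2) => n.
  have fix0 : busemann_defect h x n m p = 0.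
    by rewrite /busemann_defect -{1}mp aD subrr.
  have h1 := busemann_defect_basepoint n m x p hT.
  have h2 := busemann_defect_basepoint n m p x hT.
  rewrite fix0 in h1 h2; rewrite (metric_sym p) in h2.
  by rewrite ler_norml; apply/andP; split; lra.
have step n : mdist x (a (h ^+ n)%g x) ^+ 2 <= n%:R * C.
  elim: n => [|n IHn]; first by rewrite expg0 a1 mdistxx expr0n mul0r.
  have := le_trans (ler_norm _) (hC n); rewrite /busemann_defect expgS aM.
  by rewrite mulrSr mulrDl mul1r; lra.
apply/esym/mdist_positivity/eqP; rewrite -sqrf_eq0; apply/eqP.
apply: (@pow2_bounded_eq0 _ C) => [|k]; first exact: sqr_ge0.
have := step (2 ^ k)%N; rewrite (translation_expg2n uX X2 X3 XT aA)// natrX.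
by rewrite exprMn expr2 -mulrA ler_pM2l ?exprn_gt0.
Qed.

End CAT0Rigidity.

(** * Group actions on ultraproducts *)

Section UltraproductAction.
Context {R : realType}.
Local Open Scope quotient_scope.

Lemma nonprincipal_tail (U : set_system nat) : UltraFilter U ->
  (forall n : nat, ~ U [set n]) -> forall N, U [set n | (N <= n)%N].
Proof.
move=> UU Un; elim=> [|N IHN]; first by apply: filterS filterT.
have [/Un//|UNC] := in_ultra_setVsetC [set N] UU.
apply: filterS (filterI IHN UNC) => n [] /= Nn nN.
by rewrite ltn_neqAle Nn andbT; apply/eqP => Nn'; apply: nN.
Qed.

Definition bounded_from (X : nat -> metricType R) (w x : forall n, X n) :=
  exists C : R, forall n, mdist (x n) (w n) <= C.

Lemma bounded_from_base (X : nat -> metricType R) (w : forall n, X n) :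
  bounded_from w w.
Proof. by exists 0 => n; rewrite mdistxx. Qed.

(** An ultraproduct is handled through its class map. The map is total, which
    avoids carrying boundedness proofs inside sequences; its values on unbounded
    sequences are arbitrary. *)
Definition ultralimit (U : set_system nat) (X : nat -> metricType R)
    (w : forall n, X n) (Z : metricType R) (cls : (forall n, X n) -> Z) :=
  (forall z, exists2 x, bounded_from w x & cls x = z) /\
  forall x y, bounded_from w x -> bounded_from w y ->
    mdist (x n) (y n) @[n --> U] --> mdist (cls x) (cls y).

Lemma ultralimit_exists (XX : metricType R -> Prop) : U_closed XX ->
  exists U : set_system nat, [/\ UltraFilter U,
    forall N, U [set n | (N <= n)%N] &
    forall (X : nat -> metricType R) (w : forall n, X n),
      (forall n, XX (X n)) -> exists2 Z, XX Z &
      exists cls, @ultralimit U X w Z cls].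
Proof.
move=> [U [UU [Un XXU]]]; exists U; split=> [//||X w XXX].
  exact: nonprincipal_tail.
have [Z XXZ [f [g fK gK] fd]] := XXU X w XXX; exists Z => //.
pose sq x (b : bounded_from w x) : useq UU w := exist _ x b.
pose cls (x : forall n, X n) : Z :=
  match pselect (bounded_from w x) with
  | left b => g (\pi_(ultraproduct UU w) (sq x b))
  | right _ => g (\pi_(ultraproduct UU w) (sq w (bounded_from_base w)))
  end.
have gd u v : mdist (g u) (g v) = mdist u v by rewrite -fd !gK.
exists cls; split=> [z|x y xb yb].
  pose u := repr (f z).
  exists (sval u); first by case: (u).
  rewrite /cls; case: pselect => [b'|]; last by case; case: (u).
  rewrite -[z]fK -[f z]reprK; congr (g (\pi _)); rewrite /sq -/u.
  by case: (u) b' => s p b' /=; congr exist; exact: Prop_irrelevance.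
rewrite /cls; case: pselect => // {}xb; case: pselect => // {}yb.
rewrite gd; have := @udist_cvg R U UU X w (sq x xb) (sq y yb).
by rewrite -uprod_distE.
Qed.

Section Action.
Context (G : groupType) (U : set_system nat) (UU : UltraFilter U).
Context (X : nat -> metricType R) (w : forall n, X n).
Context (Z : metricType R) (cls : (forall n, X n) -> Z).
Context (clsZ : ultralimit U w cls).

Lemma ultralimit_mdist x y r : bounded_from w x -> bounded_from w y ->
  mdist (x n) (y n) @[n --> U] --> r -> mdist (cls x) (cls y) = r.
Proof.
move=> xb yb h; rewrite -(cvg_lim (@norm_hausdorff _ _) h).
by rewrite (cvg_lim (@norm_hausdorff _ _) (clsZ.2 _ _ xb yb)).
Qed.

Lemma ultralimit_mdist_ge x y r : bounded_from w x -> bounded_from w y ->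
  U [set n | r <= mdist (x n) (y n)] -> r <= mdist (cls x) (cls y).
Proof. by move=> xb yb h; apply: cvgr_to_ge (clsZ.2 _ _ xb yb) _. Qed.

Context (a : forall n, G -> X n -> X n) (aA : forall n, isometric_action (@a n)).
Context (aw : forall g, bounded_from w (fun n => @a n g (w n))).

Lemma bounded_from_act g x : bounded_from w x ->
  bounded_from w (fun n => @a n g (x n)).
Proof.
move=> [C xC]; have [D wD] := aw g; exists (C + D) => n.
rewrite (le_trans (metric_triangle _ (@a n g (w n)) _))//.
by rewrite lerD ?(act_dist _ _ _ (@aA n)).
Qed.

(** Bounded displacement of the base points makes each group element preserve
    bounded sequences, and isometries preserve the relation of being at limit
    distance zero. *)
Lemma ultralimit_action : exists2 A : G -> Z -> Z, isometric_action A &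
  forall g x, bounded_from w x -> A g (cls x) = cls (fun n => @a n g (x n)).
Proof.
have [rep repP] := choice (fun z => let: ex_intro2 x b e := clsZ.1 z in
  ex_intro (fun x => bounded_from w x /\ cls x = z) x (conj b e)).
have repb z : bounded_from w (rep z) by case: (repP z).
have repK z : cls (rep z) = z by case: (repP z).
pose A g z := cls (fun n => @a n g (rep z n)).
have AE g x : bounded_from w x -> A g (cls x) = cls (fun n => @a n g (x n)).
  move=> xb; apply: mdist_positivity.
  apply: ultralimit_mdist; [exact: bounded_from_act..|].
  under eq_fun do rewrite (act_dist _ _ _ (aA _)).
  by have := clsZ.2 _ _ (repb (cls x)) xb; rewrite repK mdistxx.
exists A => //; split=> [z|g h z|g y z].
- rewrite -{1}[z]repK AE// -[RHS]repK; congr cls.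
  by apply: functional_extensionality_dep => n; case: (aA n).
- rewrite -{1}[z]repK AE// -[in RHS](repK z) AE// AE; last exact: bounded_from_act.
  by congr cls; apply: functional_extensionality_dep => n; case: (aA n).
- apply: ultralimit_mdist; [exact: bounded_from_act..|].
  under eq_fun do rewrite (act_dist _ _ _ (aA _)).
  by have := clsZ.2 _ _ (repb y) (repb z); rewrite !repK.
Qed.

End Action.
End UltraproductAction.

(** * Actions with displacement bounded below *)

Section Displacement.
Context {R : realType}.

Lemma metric_complete_geometric (X : metricType R) (u : nat -> X) (C : R) :
  metric_complete X -> (forall n, mdist (u n) (u n.+1) <= C / 2 ^+ n) ->
  exists z, forall n, mdist (u n) z <= 2 * C / 2 ^+ n.
Proof.
move=> cX uC.
have C0 : 0 <= C by rewrite -[C](divr1) -(expr0 2) (le_trans _ (uC 0%N))// mdist_ge0.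
have tail n m : mdist (u n) (u (n + m)%N) <= 2 * C / 2 ^+ n - 2 * C / 2 ^+ (n + m).
  elim: m => [|m IHm]; first by rewrite addn0 mdistxx subrr.
  rewrite addnS (le_trans (metric_triangle _ (u (n + m)%N) _))//.
  have := uC (n + m)%N; rewrite exprS invfM.
  set A := _ ^-1 in IHm *; set B := _ ^-1 in IHm *; lra.
have tail' n m : (n <= m)%N -> mdist (u n) (u m) <= 2 * C / 2 ^+ n.
  move=> /subnKC <-; apply: le_trans (tail _ _) _.
  by rewrite lerBlDr lerDl !mulr_ge0// invr_ge0 exprn_ge0.
have small (e : R) : 0 < e -> exists n, 2 * C / 2 ^+ n < e.
  move=> e0; exists (Num.bound (2 * C / e)).
  have Ce : 0 <= 2 * C / e by rewrite !mulr_ge0// invr_ge0 ltW.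
  rewrite ltr_pdivrMr ?exprn_gt0// [ltRHS]mulrC -ltr_pdivrMr//.
  rewrite (lt_trans (archi_boundP Ce))// -natrX ltr_nat; exact: ltn_expl.
have [|z uz] := cX (u @ \oo) _.
  apply: cauchy_exP => e /small[n ne]; exists (u n).
  exists n => // m /= nm; rewrite ballEmdist /=.
  exact: le_lt_trans (tail' _ _ nm) ne.
exists z => n; apply/ler_addgt0Pr => e e0.
have /metricType_numDomainType.fcvgrPdist_lt/(_ e e0)[N _ Nz] := uz.
have := Nz (maxn n N) (leq_maxr _ _); rewrite /= metric_sym => uz'.
by rewrite (le_trans (metric_triangle _ (u (maxn n N)) _))// lerD ?tail' ?leq_maxl// ltW.
Qed.

Section Scale.
Context (G : groupType) (S : set G).

Definition moves_by (X : metricType R) (a : G -> X -> X) (r : R) (x : X) :=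
  exists2 s, S s & r <= mdist x (a s x).

(** The selection of Gromov and Schoen: an action without fixed points has
    points of small displacement around which, on a ball that is large relative
    to that displacement, no point has displacement less than half of it.
    Otherwise one could halve the displacement forever along a Cauchy
    sequence. *)
Lemma almost_minimal_displacement (X : metricType R) (a : G -> X -> X) (x0 : X)
    (K : R) : metric_complete X -> isometric_action a ->
  (forall x, exists2 s, S s & a s x <> x) ->
  (forall s, S s -> mdist x0 (a s x0) <= 1) ->
  exists k x, (forall s, S s -> mdist x (a s x) <= (2 ^+ k)^-1) /\
    forall y, mdist x y <= K / 2 ^+ k -> moves_by a ((2 ^+ k)^-1 / 2) y.
Proof.
move=> cX aA nofix x01; apply: contrapT => none.
pose small k x := forall s, S s -> mdist x (a s x) <= (2 ^+ k)^-1.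
have step (kx : nat * X) : exists y,
    small kx.1 kx.2 -> small kx.1.+1 y /\ mdist kx.2 y <= K / 2 ^+ kx.1.
  case: kx => k x; have [sx|] := pselect (small k x); last by exists x.
  apply: contrapT => noy; apply: none; exists k, x; split=> // y xy.
  apply: contrapT => nomove; apply: noy; exists y => _; split=> //= s Ss.
  rewrite exprS invfM mulrC leNgt; apply/negP => /ltW h.
  by apply: nomove; exists s.
have [next nextP] := choice step.
pose u := fix u k := if k is k'.+1 then next (k', u k') else x0.
have us k : small k (u k).
  elim: k => [s Ss|k IHk]; first by rewrite expr0 invr1 x01.
  by have [] := nextP (k, u k) IHk.
have ud k : mdist (u k) (u k.+1) <= K / 2 ^+ k.
  by have [] := nextP (k, u k) (us k).
have [z uz] := metric_complete_geometric cX ud.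
have [s Ss] := nofix z; apply; apply/esym/mdist_positivity.
(* The limit [z] lies within [2 * K / 2 ^+ k] of [u k], and the displacement is
   Lipschitz of constant two. *)
apply: (@pow2_bounded_eq0 _ _ (1 + 4 * K)) => [|k]; first exact: mdist_ge0.
rewrite mulrC -ler_pdivlMr ?exprn_gt0//.
have := mdist_act1 s z (u k) aA; have := us k s Ss; have := uz k.
by rewrite (metric_sym z (u k)); set A := _^-1; lra.
Qed.

Lemma ultrafilter_finite_choice (U : set_system nat) (P : G -> nat -> Prop) :
  UltraFilter U -> finite_set S -> U [set n | exists2 s, S s & P s n] ->
  exists2 s, S s & U [set n | P s n].
Proof.
move=> UU /finite_seqP[ss ->]; elim: ss => [|s ss IHss] UP.
  by exfalso; apply: (@filter_not_empty _ U); apply: filterS UP => n [].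
have [Us|Us] := in_ultra_setVsetC [set n | P s n] UU.
  by exists s => //=; rewrite inE eqxx.
have [|t tss Ut] := IHss.
  apply: filterS (filterI UP Us) => n [[t] /=].
  by rewrite inE => /orP[/eqP -> //|tss Pt _]; exists t.
by exists t => //=; rewrite inE; apply/orP; right.
Qed.

Section Limit.
Context (Sfin : finite_set S) (U : set_system nat) (UU : UltraFilter U).
Context (X : nat -> metricType R) (w : forall n, X n).
Context (Z : metricType R) (cls : (forall n, X n) -> Z).
Context (clsZ : ultralimit U w cls).
Context (a : forall n, G -> X n -> X n) (aA : forall n, isometric_action (@a n)).
Context (A : G -> Z -> Z).
Context (aw : forall g, bounded_from w (fun n => @a n g (w n))).
Context (AE : forall g x, bounded_from w x ->
  A g (cls x) = cls (fun n => @a n g (x n))).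

Lemma ultralimit_moves_by r x : bounded_from w x ->
  U [set n | moves_by (@a n) r (x n)] -> moves_by A r (cls x).
Proof.
move=> xb /(ultrafilter_finite_choice UU Sfin)[s Ss Us]; exists s => //.
rewrite AE//; apply: (ultralimit_mdist_ge UU clsZ) => //.
exact: bounded_from_act.
Qed.

End Limit.

Lemma bounded_displacement_subgroup (X : nat -> metricType R)
    (w : forall n, X n) (a : forall n, G -> X n -> X n) :
  (forall n, isometric_action (@a n)) ->
  subgroup [set g | bounded_from w (fun n => @a n g (w n))].
Proof.
move=> aA; split=> /= [|g h [C gC] [D hD]|g [C gC]].
- by exists 0 => n; case: (aA n) => -> _ _; rewrite mdistxx.
- exists (D + C) => n; case: (aA n) => _ -> aD.
  by rewrite (le_trans (metric_triangle _ (a n g (w n)) _))// lerD ?aD.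
- exists C => n; rewrite -(act_dist g _ _ (aA n)) (actKV _ _ (aA n)).
  by rewrite metric_sym.
Qed.

Context (XX : metricType R -> Prop).

(** Unlike the absence of fixed points, a uniform lower bound on displacement
    survives ultraproducts. *)
Definition uniform_action (X : metricType R) (a : G -> X -> X) :=
  isometric_action a /\ forall x, moves_by a 2^-1 x.

(** The balls of the selection lemma, rescaled so that the displacement at their
    centre is of order one, converge along an ultrafilter to an action whose
    displacement is everywhere at least one half. The rescaling factors are at
    least one because the selection starts at a point of displacement at most
    one; when there is none, the given action will do. *)
Lemma uniform_action_exists (X : metricType R) (a : G -> X -> X) :
  S_plus XX -> U_closed XX -> finite_set S -> gen S = setT ->
  XX X -> metric_complete X -> isometric_action a -> ~ (fixed_points a setT !=set0) ->
  exists (Z : metricType R) (A : G -> Z -> Z), XX Z /\ uniform_action A.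
Proof.
move=> XS XU Sfin Sgen XXX cX aA nofix.
have nofixS x : exists2 s, S s & a s x <> x.
  apply: contrapT => nos; apply: nofix; exists x => g _.
  apply: (@gen_sub _ S [set g | a g x = x]); last by rewrite Sgen.
    exact: stabilizer_subgroup.
  by move=> s Ss /=; apply: contrapT => asx; apply: nos; exists s.
have [unif|] := pselect (forall x, moves_by a 2^-1 x); first by exists X, a.
move=> /existsNP[x0 x0P].
have x01 s : S s -> mdist x0 (a s x0) <= 1.
  move=> Ss; rewrite leNgt; apply/negP => h; apply: x0P; exists s => //; lra.
have piece (K : nat) : exists p : {Y : metricType R & ((G -> Y -> Y) * Y)%type},
    [/\ XX (projT1 p), isometric_action (projT2 p).1,
      forall s, S s -> mdist (projT2 p).2 ((projT2 p).1 s (projT2 p).2) <= 1 &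
      forall y, mdist (projT2 p).2 y <= K%:R -> moves_by (projT2 p).1 2^-1 y].
  have [k [x [xs xy]]] := almost_minimal_displacement K%:R cX aA nofixS x01.
  have r1 : 1 <= (2 : R) ^+ k by rewrite exprn_ege1//; lra.
  have r0 : 0 < (2 : R) ^+ k by rewrite exprn_gt0.
  have [Y XXY [f [g fK gK] fd]] := XS X XXX _ r1.
  have {}fd u v : mdist u v = 2 ^+ k * mdist (f u : X) (f v : X) by rewrite -fd.
  have gd (u v : X) : mdist (g u) (g v) = 2 ^+ k * mdist u v by rewrite fd !gK.
  pose b h y := g (a h (f y)).
  exists (existT _ Y (b, g x)); split=> //=.
  - case: aA => a1 aM aD; split=> [y|h h' y|h y z]; rewrite /b.
    + by rewrite a1 fK.
    + by rewrite aM gK.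
    + by rewrite gd aD -fd.
  - by move=> s Ss; rewrite /b gK gd mulrC -ler_pdivlMr// mul1r xs.
  - move=> y; rewrite fd gK mulrC -ler_pdivlMr// => /xy[s Ss ys].
    exists s => //; rewrite /b fd gK mulrC -ler_pdivrMr//.
    by rewrite mulrC.
have [p pP] := choice piece.
pose Y n := projT1 (p n); pose b n := (projT2 (p n)).1.
pose w n : Y n := (projT2 (p n)).2.
have bA n : isometric_action (b n) by case: (pP n).
have [U [UU Utail Ulim]] := ultralimit_exists XU.
have [Z XXZ [cls clsZ]] := Ulim Y w (fun n => let: And4 h _ _ _ := pP n in h).
have bw g : bounded_from w (fun n => b n g (w n)).
  apply: (gen_sub (bounded_displacement_subgroup w bA) (A := S)); last by rewrite Sgen.
  by move=> s Ss; exists 1 => n; case: (pP n) => _ _ h _; rewrite metric_sym; exact: h.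
have [A AA AE] := ultralimit_action UU clsZ bA bw.
exists Z, A; split=> //; split=> // z; have [y [C yC] <-] := clsZ.1 z.
apply: (ultralimit_moves_by Sfin UU clsZ bA bw AE); first by exists C.
have C0 : 0 <= C by rewrite (le_trans _ (yC 0%N))// mdist_ge0.
apply: filterS (Utail (Num.bound C)) => n /= Cn.
have [_ _ _ farP] := pP n; apply: farP; rewrite metric_sym (le_trans (yC n))//.
by rewrite (le_trans (ltW (archi_boundP C0)))// ler_nat.
Qed.

End Scale.
End Displacement.

(** * The energy of a tuple *)

Section Energy.
Context {R : realType} {l : nat}.
Implicit Types X Y : metricType R.

(** The square makes a convex [Theta] strictly convex; see
    [energy_midpoint_parallel]. *)
Definition energy (Theta : R -> R) X (x : 'I_l -> X) : R :=
  \sum_i \sum_j Theta (mdist (x i) (x j)) ^+ 2.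

Lemma energy_perm Theta X (x : 'I_l -> X) (s : {perm 'I_l}) :
  energy Theta (x \o s) = energy Theta x.
Proof.
rewrite /energy [RHS](reindex_inj (@perm_inj _ s)); apply: eq_bigr => i _.
by rewrite [RHS](reindex_inj (@perm_inj _ s)).
Qed.

Lemma energy_isometry Theta X Y (f : X -> Y) (x : 'I_l -> X) :
  (forall u v, mdist (f u) (f v) = mdist u v) ->
  energy Theta (f \o x) = energy Theta x.
Proof. by move=> fd; apply: eq_bigr => i _; apply: eq_bigr => j _; rewrite /= fd. Qed.

Context (Theta : R -> R) (ThetaP : increasing_continuous Theta).

Lemma Theta_ge0 s : 0 <= s -> 0 <= Theta s.
Proof. by case: ThetaP => + _ _; exact. Qed.

Lemma Theta_lt s t : 0 <= s -> s < t -> Theta s < Theta t.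
Proof. by case: ThetaP => _ + _; exact. Qed.

Lemma Theta_inj s t : 0 <= s -> 0 <= t -> Theta s = Theta t -> s = t.
Proof.
move=> s0 t0 st; apply/eqP; case: ltgtP => // h.
  by have := Theta_lt s0 h; rewrite st ltxx.
by have := Theta_lt t0 h; rewrite st ltxx.
Qed.

Lemma energy_ge0 X (x : 'I_l -> X) : 0 <= energy Theta x.
Proof. by apply: sumr_ge0 => i _; apply: sumr_ge0 => j _; exact: sqr_ge0. Qed.

Lemma le_energy X (x : 'I_l -> X) i j :
  Theta (mdist (x i) (x j)) ^+ 2 <= energy Theta x.
Proof.
rewrite /energy (bigD1 i)//= (bigD1 j)//= -addrA lerDl addr_ge0//.
  by apply: sumr_ge0 => k _; exact: sqr_ge0.
by apply: sumr_ge0 => k _; apply: sumr_ge0 => m _; exact: sqr_ge0.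
Qed.

(** The convexity of [Theta] along distances is strengthened by squaring:
    between two tuples of equal energy, the midpoint tuple has strictly smaller
    energy unless all the pairs of segments are parallel. *)
Lemma energy_midpoint_parallel X (x y : 'I_l -> X) : NPC1 Theta X ->
  energy Theta x = energy Theta y ->
  energy Theta x <= energy Theta (fun i => geo_pt 2^-1 (x i) (y i)) ->
  forall i j, parallel (x i) (y i) (x j) (y j).
Proof.
move=> [uX cX] xy; set z := fun i => geo_pt _ _ _ => xz.
have h01 : 0 <= (2^-1 : R) <= 1 by apply/andP; split; lra.
pose u i j := Theta (mdist (x i) (x j)).
pose v i j := Theta (mdist (y i) (y j)).
pose m i j := Theta (mdist (z i) (z j)).
have u0 i j : 0 <= u i j by apply/Theta_ge0/mdist_ge0.
have v0 i j : 0 <= v i j by apply/Theta_ge0/mdist_ge0.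
have m0 i j : 0 <= m i j by apply/Theta_ge0/mdist_ge0.
have muv i j : m i j <= (u i j + v i j) / 2.
  have := cX (x i) (y i) (x j) (y j) 2^-1 h01.
  by rewrite -/(u i j) -/(v i j) -/(m i j); lra.
have gap i j : (u i j - v i j) ^+ 2 / 4 <=
    (u i j ^+ 2 + v i j ^+ 2) / 2 - m i j ^+ 2.
  have : m i j ^+ 2 <= ((u i j + v i j) / 2) ^+ 2.
    by rewrite lerXn2r ?nnegrE// divr_ge0// addr_ge0.
  nra.
have gap0 i j : 0 <= (u i j ^+ 2 + v i j ^+ 2) / 2 - m i j ^+ 2.
  by apply: le_trans (gap i j); rewrite divr_ge0// sqr_ge0.
have tot : \sum_i \sum_j ((u i j ^+ 2 + v i j ^+ 2) / 2 - m i j ^+ 2) = 0.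
  apply/eqP; rewrite eq_le; apply/andP; split; last first.
    by apply: sumr_ge0 => i _; apply: sumr_ge0.
  have -> : \sum_i \sum_j ((u i j ^+ 2 + v i j ^+ 2) / 2 - m i j ^+ 2) =
      (energy Theta x + energy Theta y) / 2 - energy Theta z.
    rewrite /energy -big_split /= mulr_suml -sumrB; apply: eq_bigr => i _.
    by rewrite -big_split /= mulr_suml -sumrB.
  by rewrite -xy; move: xz; lra.
move=> i j.
have e0 : (u i j ^+ 2 + v i j ^+ 2) / 2 - m i j ^+ 2 = 0.
  have := psumr_eq0P (fun i _ => sumr_ge0 _ (fun j _ => gap0 i j)) tot.
  by move=> /(_ i isT)/(psumr_eq0P (fun j _ => gap0 i j)); exact.
have uv : u i j = v i j.
  have := gap i j; rewrite e0 => h; apply/eqP; rewrite -subr_eq0 -sqrf_eq0.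
  by rewrite eq_le sqr_ge0 andbT; lra.
have vm : v i j = m i j.
  rewrite uv in e0; apply/eqP; rewrite -(@eqrXn2 _ 2)//.
  by apply/eqP; lra.
by split; apply: Theta_inj (mdist_ge0 _ _) (mdist_ge0 _ _) _.
Qed.

(** Coercivity of the energy: along a segment, convexity bounds [Theta] from below
    by a linear function of the distance, so an energy bound is a distance
    bound. *)
Lemma Theta_growth X (x y : X) : NPC1 Theta X -> 1 <= mdist x y ->
  mdist x y * (Theta 1 - Theta 0) <= Theta (mdist x y).
Proof.
move=> [uX cX] d1; have d0 : 0 < mdist x y by lra.
have t01 : 0 <= (mdist x y)^-1 <= 1.
  by rewrite invr_ge0 (ltW d0) invf_le1.
have := cX x y x x (mdist x y)^-1 t01; rewrite geo_ptxx// mdistxx.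
rewrite (metric_sym _ x) mdist_geo_ptl// mulVf ?gt_eqF// (metric_sym y x).
have T0 := Theta_ge0 (lexx 0).
have dV : mdist x y * (mdist x y)^-1 = 1 by rewrite mulfV ?gt_eqF.
set d := mdist x y in d0 dV *; set t := d^-1 in dV *.
move=> /(ler_wpM2l (ltW d0)).
have -> : d * ((1 - t) * Theta 0 + t * Theta d) =
    d * Theta 0 - (d * t) * Theta 0 + (d * t) * Theta d by ring.
by rewrite dV; lra.
Qed.

Lemma Theta_cvg (U : set_system nat) (f : nat -> R) (r : R) : UltraFilter U ->
  (forall n, 0 <= f n) -> 0 <= r -> f @ U --> r ->
  Theta (f n) @[n --> U] --> Theta r.
Proof.
move=> UU f0 r0 fr; case: ThetaP => _ _ /subspace_continuousP/(_ r r0) Tr.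
apply: cvg_trans Tr => P PT; have fP := fr _ PT.
by apply: (@filterS _ U _ _ _ _ fP) => n /=; apply; exact: f0.
Qed.

Lemma energy_ultralimit (U : set_system nat) (X : nat -> metricType R)
    (w : forall n, X n) (Z : metricType R) (cls : (forall n, X n) -> Z)
    (x : forall i : 'I_l, forall n, X n) : UltraFilter U ->
  ultralimit U w cls -> (forall i, bounded_from w (x i)) ->
  energy Theta (fun i => x i n) @[n --> U] --> energy Theta (fun i => cls (x i)).
Proof.
move=> UU clsZ xb; apply: cvg_big => [|i _]; first exact: add_continuous.
apply: cvg_big => [|j _]; first exact: add_continuous.
under eq_fun do rewrite expr2.
rewrite expr2.
by apply: cvgM; apply: Theta_cvg => // [n||]; rewrite ?mdist_ge0//; exact: clsZ.2.
Qed.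

End Energy.

(** * Minimal configurations and the game *)

Section Realizer.
Context {R : realType} (XX : metricType R -> Prop).
Context (Theta : R -> R) (ThetaP : increasing_continuous Theta).
Context (XX_NPC1 : forall X, XX X -> NPC1 Theta X).
Context {G : groupType} (S : set G) (Sfin : finite_set S).
Context {l : nat} (M : 'I_l -> set G).

Definition configuration (X : metricType R) (a : G -> X -> X) (x : 'I_l -> X) :=
  [/\ XX X, uniform_action S a & forall i, fixed_points a (M i) (x i)].

(** The competitors range over all the actions in the class at once, not only
    over the tuples of one action: this is what allows the action to be twisted
    by an automorphism later on. *)
Definition minimal_configuration (X : metricType R) (a : G -> X -> X)
    (x : 'I_l -> X) :=
  configuration a x /\ forall (Y : metricType R) (b : G -> Y -> Y) y,
    configuration b y -> energy Theta x <= energy Theta y.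

Context (XX_U : U_closed XX) (i0 : 'I_l).
Context (M_gen : gen (\bigcup_i M i) = setT).
Context (M_F : forall i, relative_F XX (M i)).

Lemma configuration_spread (X : metricType R) (a : G -> X -> X) x i j E :
  configuration a x -> energy Theta x <= E ->
  mdist (x i) (x j) <= 1 + (1 + E) / (Theta 1 - Theta 0).
Proof.
move=> [XXX _ _] xE; have T01 := Theta_lt ThetaP (lexx 0) ltr01.
have E0 : 0 <= E := le_trans (energy_ge0 _ _) xE.
have C0 : 0 <= (1 + E) / (Theta 1 - Theta 0) by rewrite divr_ge0//; lra.
have [d1|d1] := leP (mdist (x i) (x j)) 1; first by lra.
rewrite (@le_trans _ _ ((1 + E) / (Theta 1 - Theta 0)))//; last by lra.
rewrite ler_pdivlMr ?subr_gt0//.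
apply: le_trans (Theta_growth ThetaP (XX_NPC1 XXX) (ltW d1)) _.
(* The energy bounds [Theta ^ 2], hence also [Theta], since [t <= 1 + t ^ 2]. *)
have := le_trans (le_energy Theta x i j) xE.
set t := Theta _ => h; have := sqr_ge0 (t - 1); nra.
Qed.

(** Take a minimizing sequence and its ultraproduct based at the points of index
    [i0]. The group acts on it, because each [M i] fixes a point at bounded
    distance from the base points and these subgroups generate. *)
Lemma minimal_configuration_exists (X : metricType R) (a : G -> X -> X) :
  XX X -> uniform_action S a ->
  exists (Z : metricType R) (A : G -> Z -> Z) z, minimal_configuration A z.
Proof.
move=> XXX aU; have [p aP] := choice (fun i => M_F i XXX aU.1).
pose Es := [set E | exists (Y : metricType R) (b : G -> Y -> Y) y,
  configuration b y /\ energy Theta y = E].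
have Es_inf : has_inf Es.
  split; first by exists (energy Theta p), X, a, p.
  by exists 0 => _ [Y [b [y [_ <-]]]]; exact: energy_ge0.
pose D := inf Es.
have DP (Y : metricType R) (b : G -> Y -> Y) y :
    configuration b y -> D <= energy Theta y.
  by move=> by_; apply: ge_inf; [exact: Es_inf.2|exists Y, b, y].
have approx (n : nat) :
    exists q : {Y : metricType R & ((G -> Y -> Y) * ('I_l -> Y))%type},
    configuration (projT2 q).1 (projT2 q).2 /\
    energy Theta (projT2 q).2 <= D + n.+1%:R^-1.
  have n0 : 0 < (n.+1%:R : R)^-1 by rewrite invr_gt0.
  have [_ [Y [b [y [by_ <-]]]] /ltW yD] := inf_adherent n0 Es_inf.
  by exists (existT _ Y (b, y)).
have [q qP] := choice approx.
pose Y n := projT1 (q n); pose b n := (projT2 (q n)).1.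
pose y i n : Y n := (projT2 (q n)).2 i; pose w := y i0.
have yc n : configuration (b n) (fun i => y i n) by case: (qP n).
have bU n : uniform_action S (b n) by case: (yc n).
have bA n : isometric_action (b n) by case: (bU n).
have yE n : energy Theta (fun i => y i n) <= D + n.+1%:R^-1 by case: (qP n).
have yE1 n : energy Theta (fun i => y i n) <= D + 1.
  by apply: le_trans (yE n) _; rewrite lerD2l invf_le1// ler1n.
have yb i : bounded_from w (y i).
  exists (1 + (1 + (D + 1)) / (Theta 1 - Theta 0)) => n.
  exact: configuration_spread (yc n) (yE1 n).
have [U [UU Utail Ulim]] := ultralimit_exists XX_U.
have [Z XXZ [cls clsZ]] := Ulim Y w (fun n => let: And3 h _ _ := yc n in h).
have bw g : bounded_from w (fun n => b n g (w n)).
  apply: (gen_sub (bounded_displacement_subgroup w bA) (A := \bigcup_i M i));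
    last by rewrite M_gen.
  move=> m [i _ Mm]; have [C yC] := yb i; exists (2 * C) => n.
  have [_ _ /(_ i m Mm) fix_y] := yc n.
  rewrite metric_sym; have := mdist_act1 m (w n) (y i n) (bA n).
  by rewrite fix_y mdistxx add0r (metric_sym (w n) (y i n)); have := yC n; lra.
have [A AA AE] := ultralimit_action UU clsZ bA bw.
have Zc : configuration A (fun i => cls (y i)).
  split=> //; last first.
    move=> i m Mm; rewrite AE//; congr cls.
    by apply: functional_extensionality_dep => n; case: (yc n) => _ _; exact.
  split=> // z; have [v vb <-] := clsZ.1 z.
  apply: (ultralimit_moves_by Sfin UU clsZ bA bw AE) => //.
  by apply: (@filterS _ U _ setT) => [n _|]; [exact: (bU n).2|exact: filterT].
exists Z, A, (fun i => cls (y i)); split=> // Y' b' y' /DP; apply: le_trans.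
apply/ler_addgt0Pr => e e0.
apply: (cvgr_to_le (energy_ultralimit ThetaP UU clsZ yb)).
apply: filterS (Utail (Num.bound e^-1)) => n /= en.
apply: le_trans (yE n) _; rewrite lerD2l invf_ple ?posrE//.
have e1 : 0 <= e^-1 by rewrite invr_ge0 ltW.
by rewrite (le_trans (ltW (archi_boundP e1)))// ler_nat ltnW.
Qed.

End Realizer.

Section GameInvariant.
Context {R : realType} (XX : metricType R -> Prop).
Context (Theta : R -> R) (ThetaP : increasing_continuous Theta).
Context (XX_NPC1 : forall X, XX X -> NPC1 Theta X).
Context (XX_NPC2 : forall X, XX X -> NPC2 X) (XX_TP : forall X, XX X -> TP X).
Context {G : groupType} (S : set G) {l : nat} (M : 'I_l -> set G).
Context (M_gen : gen (\bigcup_i M i) = setT).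
Context (Pi : set (G -> G)) (Pi_sub : aut_subgroup Pi).
Context (S_Pi : forall p s, Pi p -> S s -> S (p s)).

Lemma minimal_parallel (X : metricType R) (a : G -> X -> X) x y :
  minimal_configuration XX Theta S M a x -> configuration XX S M a y ->
  energy Theta y = energy Theta x ->
  forall i j, parallel (x i) (y i) (x j) (y j).
Proof.
move=> [[XXX aU xM] xmin] [_ _ yM] yx.
have uX := (XX_NPC1 XXX).1.
have h01 : 0 <= (2^-1 : R) <= 1 by apply/andP; split; lra.
apply: (energy_midpoint_parallel ThetaP (XX_NPC1 XXX)); first by rewrite yx.
apply: (xmin _ a); split=> // i m Mm.
rewrite (geo_pt_isometry _ _ uX uX _ h01) ?xM ?yM//.
by move=> u v; exact: act_dist aU.1.
Qed.

(** The vector from [x i] to [y i] is parallel to the one from [x j] to [y j],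
    which [M j] fixes. As the [M j] generate [G], its parallelism class is
    [G]-invariant. *)
Lemma minimal_translation (X : metricType R) (a : G -> X -> X) x i h :
  minimal_configuration XX Theta S M a x ->
  (exists2 y, configuration XX S M a y &
    energy Theta y = energy Theta x /\ y i = a h (x i)) ->
  translation_at a (x i) h.
Proof.
move=> xmin [y yc [yx yi]] g; have par := minimal_parallel xmin yc yx.
have [[XXX [aA _] xM] _] := xmin; have [_ _ yM] := yc.
have uX := (XX_NPC1 XXX).1; have XT := XX_TP XXX.
rewrite -yi; apply: (gen_sub (parallel_invariant_subgroup uX XT aA (x i) (y i))
  (A := \bigcup_i M i)); last by rewrite M_gen.
move=> m [j _ Mm] /=; apply: XT (par i j) _.
have := parallel_act uX aA m (par j i).
by rewrite xM// yM.
Qed.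

(** The invariant of the game. It concerns every minimal configuration over every
    action, so that a move of type II can use it for the twisted action. *)
Definition minimal_fixed (H : 'I_l -> set G) :=
  forall (X : metricType R) (a : G -> X -> X) x,
  minimal_configuration XX Theta S M a x -> forall i, fixed_points a (H i) (x i).

Context (adm : set G -> Prop).
Context (rigid : forall (X : metricType R) (a : G -> X -> X) P x,
  XX X -> isometric_action a -> adm P -> gen P `<=` translation_at a x ->
  forall q, P q -> a q x = x).

(** Moving a minimal tuple by [h] and permuting it by [tau] gives another minimal
    tuple. At an index fixed by [tau] the two differ by the displacement of [h],
    which is therefore a translation. *)
Lemma move_I_minimal_fixed H H' :
  minimal_fixed H -> move_I adm M H H' -> minimal_fixed H'.
Proof.
move=> Hfix [tau [P [_ Padm PM H'E]]] X a x xmin i.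
have [[XXX aU xM] _] := xmin; have aA := aU.1; have [a1 aM aD] := aA.
rewrite H'E; case: eqP => [taui|_]; last exact: Hfix xmin i.
have tauVi : (tau^-1)%g i = i by rewrite -{1}taui permK.
apply: gen_sub (stabilizer_subgroup (x i) aA) _.
move=> q [/(Hfix _ _ _ xmin i)//|Pq] /=.
apply: (rigid XXX aA Padm _ Pq).
apply: gen_sub; first exact: translation_subgroup (XX_NPC2 XXX) (XX_TP XXX) _ aA _.
move=> h Ph; apply: (minimal_translation (x := x) xmin).
exists (fun j => a h (x ((tau^-1)%g j))); last first.
  split; last by rewrite tauVi.
  rewrite -(energy_perm Theta x (tau^-1)%g).
  by rewrite -(energy_isometry Theta (x \o (tau^-1)%g) (aD h)).
split=> // j m Mm; have := PM h ((tau^-1)%g j) Ph; rewrite permKV.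
move=> /(_ m Mm)[k Hk <-]; rewrite /conj_by !aM -[a h^-1%g _]aM mulVg a1.
by rewrite (Hfix _ _ _ xmin).
Qed.

(** Since [H i] fixes [x i], the condition on [phi] makes [x], relabelled by
    [sigma], a configuration for the action twisted by [phi]. Its energy is the
    same, so it is minimal, and the invariant for the twisted action says that
    [phi] maps [H (sigma i)] into the stabilizer of [x i]. *)
Lemma move_II_minimal_fixed H H' :
  minimal_fixed H -> move_II M Pi H H' -> minimal_fixed H'.
Proof.
move=> Hfix [sigma [Lam [LamPi LamM H'E]]] X a x xmin i.
have [[XXX aU xM] min] := xmin; have aA := aU.1; have [a1 aM aD] := aA.
rewrite H'E; apply: gen_sub (stabilizer_subgroup (x i) aA) _.
move=> _ [/(Hfix _ _ _ xmin i)//|[phi Lphi [k Hk <-]]] /=.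
have [g [p Pp phiE]] := LamPi phi Lphi.
have [Piaut _ _ PiV] := Pi_sub.
have [[q pK qK] pM] := Piaut p Pp; have Pq := PiV p q Pp pK qK.
have p1 : p 1%g = 1%g by apply: (mulgI (p 1%g)); rewrite -pM !mulg1.
pose b k := a (phi k).
have phi1 : phi 1%g = 1%g by rewrite phiE /= /conj_by p1 mulg1 mulgV.
have phiM u v : phi (u * v)%g = (phi u * phi v)%g.
  by rewrite phiE /= /conj_by pM !mulgA mulgVK.
have bU : uniform_action S b.
  split; first by split=> [y|u v y|u y z]; rewrite /b ?phi1 ?phiM ?a1 ?aM ?aD.
  move=> y; have [s Ss sy] := aU.2 (a g^-1%g y).
  exists (q s); first exact: S_Pi.
  rewrite /b phiE /= qK /conj_by !aM.
  by rewrite -(aD g^-1%g) -(aM g^-1%g g) mulVg a1.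
pose y j := x ((sigma^-1)%g j).
have ymin : minimal_configuration XX Theta S M b y.
  split; last first.
    by move=> Y c z /min; rewrite -[energy Theta x](energy_perm Theta x (sigma^-1)%g).
  split=> // j m Mm; apply: (Hfix _ _ _ xmin).
  have := LamM phi ((sigma^-1)%g j) Lphi; rewrite permKV; apply.
  by exists m.
have := Hfix _ _ _ ymin (sigma i) k Hk.
by rewrite /y permK.
Qed.

Lemma winning_strategy_minimal_fixed : winning_strategy adm M Pi ->
  forall (X : metricType R) (a : G -> X -> X) x,
  minimal_configuration XX Theta S M a x -> fixed_points a setT !=set0.
Proof.
move=> [H MH [i HT]] X a x xmin.
have Hfix : minimal_fixed H.
  have : minimal_fixed M by move=> Y b y [[_ _ yM] _].
  elim: MH => {H HT} // [H H' [|]|H1 H2 H3 _ h12 _ h23 /h12/h23//].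
    by move=> mv /move_I_minimal_fixed; apply.
  by move=> mv /move_II_minimal_fixed; apply.
by exists (x i); rewrite -HT; exact: Hfix.
Qed.

End GameInvariant.

(** * Banach spaces: uniform convexity *)

Section BanachGeometry.
Context {R : realType} (E : normedModType R) (X : metricType R) (f : E -> X).
Context (uX : uniquely_geodesic X) (fbij : bijective f).
Context (fd : forall u v, mdist (f u) (f v) = `|u - v|).

Lemma normed_midl (x y : E) : `|x - 2^-1 *: (x + y)| = `|x - y| / 2.
Proof.
have -> : x - 2^-1 *: (x + y) = 2^-1 *: (x - y).
  rewrite scalerDr scalerBr opprD addrA -{1}[x]scale1r -scalerBl.
  by congr (_ *: _ - _); lra.
by rewrite normrZ ger0_norm// mulrC.
Qed.

Lemma normed_midr (x y : E) : `|2^-1 *: (x + y) - y| = `|x - y| / 2.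
Proof. by rewrite distrC [x + y]addrC normed_midl distrC. Qed.

Lemma geo_pt_normed (x y : E) : geo_pt 2^-1 (f x) (f y) = f (2^-1 *: (x + y)).
Proof.
apply/esym/midpoint_unique => //; rewrite !fd; last exact: normed_midr.
exact: normed_midl.
Qed.

Lemma normed_midpoint (x y z : E) :
  `|x - z| = `|x - y| / 2 -> `|z - y| = `|x - y| / 2 -> z = 2^-1 *: (x + y).
Proof.
move=> xz zy; apply: (bij_inj fbij); rewrite -geo_pt_normed.
by apply: midpoint_unique; rewrite ?fd.
Qed.

Lemma parallel_normed (x y x' y' : E) :
  parallel (f x) (f y) (f x') (f y') -> y - x = y' - x'.
Proof.
case; rewrite !geo_pt_normed !fd -scalerBr normrZ ger0_norm// => h1 h2.
have e : x + y - (x' + y') = (x - x') + (y - y') by rewrite opprD addrACA.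
rewrite e in h2; set u := x - x' in h1 h2; set v := y - y' in h1 h2.
have := @normed_midpoint 0 (u + v) u.
rewrite !sub0r !normrN opprD addNKr normrN add0r => mid.
have /(congr1 (fun z => 2 *: z)) : u = 2^-1 *: (u + v).
  by apply: mid; lra.
rewrite scalerA mulfV// scale1r scaler_nat mulr2n => /addrI uv.
apply/eqP; rewrite -subr_eq0; apply/eqP.
have -> : y - x - (y' - x') = v - u.
  by rewrite /u /v !opprB [x' - y']addrC addrACA [x' - x]addrC.
by rewrite uv subrr.
Qed.

End BanachGeometry.

Section UniformConvexity.
Context {R : realType} (XX : metricType R -> Prop) (XX_U : U_closed XX).
Context (XX_geod : forall X, XX X -> uniquely_geodesic X).
Context (E : normedModType R) (X : metricType R) (XXX : XX X) (f : E -> X).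
Context (fd : forall u v, mdist (f u) (f v) = `|u - v|).

(** Uniform convexity is strict convexity of the ultrapower: a sequence of
    almost flat pairs [u], [v] would give a segment from [u] to [- v] whose
    midpoint is both [0] and [(u - v) / 2]. *)
Lemma uniform_convexity_normalized : exists n : nat, forall u v : E,
  `|u| + `|v| = 1 -> (`|u| ^+ 2 + `|v| ^+ 2) / 4 <= `|u - v| ^+ 2 ->
  `|u + v| ^+ 2 <= 2 * (`|u| ^+ 2 + `|v| ^+ 2) - n.+1%:R^-1.
Proof.
apply: contrapT => /forallNP noE.
have {noE} [p pP] : {p : nat -> E * E & forall n, [/\ `|(p n).1| + `|(p n).2| = 1,
    (`|(p n).1| ^+ 2 + `|(p n).2| ^+ 2) / 4 <= `|(p n).1 - (p n).2| ^+ 2 &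
    2 * (`|(p n).1| ^+ 2 + `|(p n).2| ^+ 2) - n.+1%:R^-1 <= `|(p n).1 + (p n).2| ^+ 2]}.
  apply: (@choice _ _ (fun n q => [/\ `|q.1| + `|q.2| = 1,
    (`|q.1| ^+ 2 + `|q.2| ^+ 2) / 4 <= `|q.1 - q.2| ^+ 2 &
    2 * (`|q.1| ^+ 2 + `|q.2| ^+ 2) - n.+1%:R^-1 <= `|q.1 + q.2| ^+ 2])) => n.
  apply: contrapT => nop; apply: (noE n) => u v uv1 uv2.
  rewrite leNgt; apply/negP => /ltW uv3; apply: nop.
  by exists (u, v).
pose u n := (p n).1; pose v n := (p n).2.
have uv1 n : `|u n| + `|v n| = 1 by case: (pP n).
have uv2 n : (`|u n| ^+ 2 + `|v n| ^+ 2) / 4 <= `|u n - v n| ^+ 2 by case: (pP n).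
have uv3 n : 2 * (`|u n| ^+ 2 + `|v n| ^+ 2) - n.+1%:R^-1 <= `|u n + v n| ^+ 2.
  by case: (pP n).
have half (z : E) : `|2^-1 *: z| = `|z| / 2 by rewrite normrZ ger0_norm// mulrC.
have [U [UU Utail Ulim]] := ultralimit_exists XX_U.
pose w (n : nat) := f 0.
have [Z XXZ [cls clsZ]] := Ulim (fun=> X) w (fun=> XXX).
have uZ := XX_geod XXZ.
have bnd (s : nat -> E) : (forall n, `|s n| <= 1) -> bounded_from w (fun n => f (s n)).
  by move=> s1; exists 1 => n; rewrite fd subr0.
have ub : bounded_from w (fun n => f (u n)).
  by apply: bnd => n; have := normr_ge0 (v n); have := uv1 n; lra.
have vb : bounded_from w (fun n => f (- v n)).
  by apply: bnd => n; rewrite normrN; have := normr_ge0 (u n); have := uv1 n; lra.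
pose m n := 2^-1 *: (u n - v n).
have mb : bounded_from w (fun n => f (m n)).
  apply: bnd => n; rewrite /m half; have := ler_normB (u n) (v n).
  by have := uv1 n; lra.
have wb : bounded_from w w := bounded_from_base w.
pose A := cls (fun n => f (u n)); pose B := cls (fun n => f (- v n)).
pose O := cls w; pose Q := cls (fun n => f (m n)).
have ca : `|u n| @[n --> U] --> mdist A O.
  by have := clsZ.2 _ _ ub wb; under eq_fun do rewrite fd subr0.
have cb : `|v n| @[n --> U] --> mdist O B.
  by have := clsZ.2 _ _ wb vb; under eq_fun do rewrite fd sub0r opprK.
have ce : `|u n + v n| @[n --> U] --> mdist A B.
  by have := clsZ.2 _ _ ub vb; under eq_fun do rewrite fd opprK.
have ce2 : `|u n + v n| / 2 @[n --> U] --> mdist A B / 2.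
  by apply: cvgM ce _; exact: cvg_cst.
have AQ : mdist A Q = mdist A B / 2.
  apply: (ultralimit_mdist UU clsZ ub mb).
  by under eq_fun do rewrite fd normed_midl opprK.
have QB : mdist Q B = mdist A B / 2.
  apply: (ultralimit_mdist UU clsZ mb vb).
  by under eq_fun do rewrite fd normed_midr opprK.
(* The squared norms of [u n] and [v n] add up to at least one half, so the norm
   of [u n - v n] is at least one fourth. *)
have OQ : 1 / 8 <= mdist O Q.
  apply: (ultralimit_mdist_ge UU clsZ wb mb).
  apply: (@filterS _ U _ setT) => [n _ /=|]; last exact: filterT.
  rewrite fd sub0r normrN /m half; have := uv2 n; have := uv1 n.
  have := normr_ge0 (u n - v n); set t := `|u n - v n|.
  have := sqr_ge0 (`|u n| - `|v n|); nra.
set a := mdist A O in ca; set b := mdist O B in cb.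
set e := mdist A B in ce ce2 AQ QB.
have ab : a + b = 1.
  apply/eqP; rewrite eq_le (cvgr_to_le (cvgD ca cb)) ?(cvgr_to_ge (cvgD ca cb))//;
    by apply: (@filterS _ U _ setT) => [n _ /=|]; [rewrite -(uv1 n); exact: lexx|exact: filterT].
have e1 : e <= 1.
  apply: (cvgr_to_le ce).
  apply: (@filterS _ U _ setT) => [n _ /=|]; last exact: filterT.
  by rewrite -(uv1 n) ler_normD.
have e2 : 2 * (a ^+ 2 + b ^+ 2) <= e ^+ 2.
  rewrite -subr_ge0; apply/ler_addgt0Pr => y y0; rewrite -lerBlDr sub0r.
  move: y y0; suff key (x : R) : 0 < x -> - x <= e ^+ 2 - 2 * (a ^+ 2 + b ^+ 2).
    by [].
  move=> x0.
  have cg : `|u n + v n| ^+ 2 - 2 * (`|u n| ^+ 2 + `|v n| ^+ 2) @[n --> U]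
      --> e ^+ 2 - 2 * (a ^+ 2 + b ^+ 2).
    under eq_fun do rewrite !expr2.
    rewrite !expr2; apply: cvgB; first by apply: cvgM.
    by apply: cvgM; [exact: cvg_cst|apply: cvgD; apply: cvgM].
  apply: (cvgr_to_ge cg); apply: filterS (Utail (Num.bound x^-1)) => n /= xn.
  have : n.+1%:R^-1 <= x.
    rewrite invf_ple ?posrE//; have x1 : 0 <= x^-1 by rewrite invr_ge0 ltW.
    by rewrite (le_trans (ltW (archi_boundP x1)))// ler_nat ltnW.
  by have := uv3 n; set d := n.+1%:R^-1; move: d => d; lra.
have e0 : 0 <= e := mdist_ge0 _ _.
have abE : a = b.
  apply/eqP; rewrite -subr_eq0 -sqrf_eq0 eq_le sqr_ge0 andbT; nra.
have eE : e = 1 by apply/eqP; rewrite eq_le e1 /=; rewrite abE in ab e2; nra.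
have OQE : O = Q.
  by rewrite (midpoint_unique uZ (x := A) (y := B) (z := O)) -?/a -?/b -?/e
    -?(midpoint_unique uZ AQ QB)//; lra.
by move: OQ; rewrite OQE mdistxx; lra.
Qed.

(** The form of uniform convexity that can be summed over families: on average,
    [u] and [v] lose against the parallelogram bound in proportion to the mean
    square of [u - v]. *)
Lemma uniform_convexity : exists2 k : R, 0 < k <= 1 & forall u v : E,
  `|u + v| ^+ 2 <= 2 * (`|u| ^+ 2 + `|v| ^+ 2)
    - k * (`|u - v| ^+ 2 - (`|u| ^+ 2 + `|v| ^+ 2) / 4).
Proof.
have [n nP] := uniform_convexity_normalized.
have d0 : 0 < (n.+1%:R : R)^-1 by rewrite invr_gt0.
have d1 : (n.+1%:R : R)^-1 <= 1 by rewrite invf_le1 ?ler1n.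
move: nP d0 d1; set d := n.+1%:R^-1 => nP; move: d nP => d nP d0 d1.
exists (d / 2); first by apply/andP; split; lra.
have par (u v : E) : `|u + v| ^+ 2 <= 2 * (`|u| ^+ 2 + `|v| ^+ 2).
  have : `|u + v| ^+ 2 <= (`|u| + `|v|) ^+ 2.
    by rewrite lerXn2r ?nnegrE ?addr_ge0// ler_normD.
  by have := sqr_ge0 (`|u| - `|v|); nra.
move=> u v; have [uv|uv] := leP ((`|u| ^+ 2 + `|v| ^+ 2) / 4) (`|u - v| ^+ 2); last first.
  by have := par u v; nra.
have uv' := par u (- v); rewrite normrN in uv'.
have [t0|t0] := eqVneq (`|u| + `|v|) 0.
  have := normr_ge0 u; have := normr_ge0 v => v0 u0.
  have u00 : `|u| = 0 by lra.
  have v00 : `|v| = 0 by lra.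
  by rewrite (normr0_eq0 u00) (normr0_eq0 v00) addr0 subr0 normr0; nra.
have {}t0 : 0 < `|u| + `|v| by rewrite lt_def t0 addr_ge0.
set t := `|u| + `|v| in t0; have tV : 0 < t^-1 by rewrite invr_gt0.
have sc (z : E) : `|t^-1 *: z| = t^-1 * `|z| by rewrite normrZ gtr0_norm.
have := nP (t^-1 *: u) (t^-1 *: v).
rewrite -scalerDr -scalerBr !sc !exprMn -!mulrDr -/t mulVf ?gt_eqF//.
rewrite -mulrA ler_pM2l ?exprn_gt0// => /(_ erefl uv).
move=> h.
have tt : t ^+ 2 * t^-1 ^+ 2 = 1 by rewrite -exprMn mulfV ?gt_eqF// expr1n.
have {}h : `|u + v| ^+ 2 <= 2 * (`|u| ^+ 2 + `|v| ^+ 2) - d * t ^+ 2.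
  have h2 := ler_wpM2l (sqr_ge0 t) h; move: h2.
  set s := `|u| ^+ 2 + _; set T := t ^+ 2 in tt *; set T' := t^-1 ^+ 2 in tt *.
  have e1 (y : R) : T * (T' * y) = y by rewrite mulrA tt mul1r.
  by rewrite mulrBr [T * (2 * _)]mulrCA !e1 [T * d]mulrC.
have st : `|u| ^+ 2 + `|v| ^+ 2 <= t ^+ 2.
  by rewrite /t sqrrD; have := mulr_ge0 (normr_ge0 u) (normr_ge0 v); lra.
nra.
Qed.

End UniformConvexity.

(** * Invariant vectors and coinvariants *)

Section InvariantVectors.
Context {R : realType} (E : normedModType R) {G : groupType}.
Context (k : R) (k01 : 0 < k <= 1) (convex_E : forall u v : E,
  `|u + v| ^+ 2 <= 2 * (`|u| ^+ 2 + `|v| ^+ 2)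
    - k * (`|u - v| ^+ 2 - (`|u| ^+ 2 + `|v| ^+ 2) / 4)).
Context (pi : G -> E -> E) (piD : forall g, {morph pi g : u v / u + v}).
Context (pi1 : forall v, pi 1%g v = v).
Context (piM : forall g h v, pi (g * h)%g v = pi g (pi h v)).
Context (pi_norm : forall g v, `|pi g v| = `|v|).

Let pi0 g : pi g 0 = 0.
Proof. by apply: (@addrI _ (pi g 0)); rewrite -piD !addr0. Qed.

Let piN g v : pi g (- v) = - pi g v.
Proof. by apply/eqP; rewrite -addr_eq0 -piD addNr pi0. Qed.

Let pi_sum (I : finType) g (F : I -> E) : pi g (\sum_i F i) = \sum_i pi g (F i).
Proof. exact: (big_morph (pi g) (piD g) (pi0 g)). Qed.

Let piMn g v n : pi g (v *+ n) = pi g v *+ n.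
Proof. by elim: n => [|n IHn]; rewrite ?mulr0n// !mulrS piD IHn. Qed.

Let piVK g v : pi g (pi g^-1%g v) = v.
Proof. by rewrite -piM mulgV pi1. Qed.

(** A uniformly distributed step of an affine random walk, with rotation [gam]
    and translation [y]. The translations are centred, but they drift along [c]
    once rotated. *)
Definition drift_family (c : E) (q : R) := exists (I : finType) (gam : I -> G)
    (y : I -> E), [/\ (0 < #|I|)%N, \sum_i y i = 0,
  \sum_i pi (gam i) (y i) = c *+ #|I| & \sum_i `|y i| ^+ 2 <= q * #|I|%:R].

(** Rotations preserve norms, so the drift is bounded by the mean norm of the
    steps. *)
Lemma drift_family_norm c q : drift_family c q -> `|c| ^+ 2 <= q.
Proof.
move=> [I [gam [y [I0 _ yc yq]]]]; have N0 : 0 < #|I|%:R :> R by rewrite ltr0n.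
rewrite -(ler_pM2r N0); apply: le_trans yq.
have h1 : `|c| * #|I|%:R <= \sum_i `|y i|.
  rewrite mulr_natr -normrMn -yc (le_trans (ler_norm_sum _ _ _))//.
  by apply: ler_sum => i _; rewrite pi_norm.
have h2 : \sum_i (2 * `|c| * `|y i| - `|c| ^+ 2) <= \sum_i `|y i| ^+ 2.
  by apply: ler_sum => i _; have := sqr_ge0 (`|c| - `|y i|); nra.
apply: le_trans h2; rewrite sumrB -mulr_sumr sumr_const -mulr_natr.
by have := normr_ge0 c; nra.
Qed.

(** Two independent steps of the affine random walk with rotation [gam] and
    translation [y]. The drift doubles. The mean square would be multiplied by
    [4] if the two steps were aligned, but the second step is centred given the
    first one, so that they are not, and uniform convexity gives a definite
    gain. *)
Lemma drift_family_double c q : (forall g, pi g c = c) ->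
  drift_family c q -> drift_family (c *+ 2) ((4 - k / 2) * q).
Proof.
move=> cfix [I [gam [y [I0 y0 yc yq]]]].
have N0 : 0 < #|I|%:R :> R by rewrite ltr0n.
pose v i j := pi (gam i)^-1%g (y j).
exists (I * I)%type, (fun p => gam p.2 * gam p.1)%g, (fun p => y p.1 + v p.1 p.2).
split.
- by rewrite card_prod muln_gt0 I0.
- rewrite -(pair_bigA _ (fun i j => y i + v i j)) /=.
  under eq_bigr => i _ do rewrite big_split /= sumr_const -pi_sum y0 pi0 addr0.
  by rewrite sumrMnl y0 mul0rn.
- rewrite -(pair_bigA _ (fun i j => pi (gam j * gam i)%g (y i + v i j))) /=.
  rewrite exchange_big /=.
  under eq_bigr => j _.
    under eq_bigr => i _ do rewrite piM piD piVK piD.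
    rewrite big_split /= -pi_sum yc piMn cfix sumr_const.
    over.
  rewrite big_split /= sumr_const sumrMnl yc card_prod -!mulrnA -mulrnDr.
  by congr (c *+ _); rewrite mul2n addnn.
- rewrite -(pair_bigA _ (fun i j => `|y i + v i j| ^+ 2)) /= card_prod natrM.
  pose N : R := #|I|%:R; pose T := \sum_i `|y i| ^+ 2.
  have vn i j : `|v i j| = `|y j| by rewrite pi_norm.
  have sumv i : \sum_j `|v i j| ^+ 2 = T by under eq_bigr do rewrite vn.
  have cst (x : R) : \sum_(j : I) x = N * x by rewrite sumr_const mulr_natl.
  (* The [v i j] average to zero over [j], so the [y i - v i j] average to
     [y i]. *)
  have sumd i : N * `|y i| ^+ 2 <= \sum_j `|y i - v i j| ^+ 2.
    have h1 : N * `|y i| <= \sum_j `|y i - v i j|.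
      rewrite mulr_natl -normrMn.
      have -> : y i *+ #|I| = \sum_j (y i - v i j).
        by rewrite sumrB sumr_const -pi_sum y0 pi0 subr0.
      exact: ler_norm_sum.
    have h2 : \sum_j (2 * `|y i| * `|y i - v i j| - `|y i| ^+ 2) <=
        \sum_j `|y i - v i j| ^+ 2.
      by apply: ler_sum => j _; have := sqr_ge0 (`|y i| - `|y i - v i j|); nra.
    apply: le_trans h2; rewrite sumrB -mulr_sumr cst.
    by have := normr_ge0 (y i); nra.
  have row i : \sum_j `|y i + v i j| ^+ 2 <=
      (2 + k / 4 - k) * N * `|y i| ^+ 2 + (2 + k / 4) * T.
    apply: (@le_trans _ _ (\sum_j ((2 + k / 4) * `|y i| ^+ 2
        + (2 + k / 4) * `|v i j| ^+ 2 - k * `|y i - v i j| ^+ 2))).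
      by apply: ler_sum => j _; have := convex_E (y i) (v i j); lra.
    rewrite sumrB big_split /= cst -!mulr_sumr sumv.
    by have := sumd i; case/andP: k01 => k0 _; nra.
  apply: (le_trans (ler_sum _ (fun i _ => row i))).
  rewrite big_split /= cst -mulr_sumr -/T.
  have -> : (2 + k / 4 - k) * N * T + N * ((2 + k / 4) * T) = (4 - k / 2) * N * T by lra.
  rewrite -mulrA [N * T]mulrC !mulrA ler_pM2r//.
  rewrite -!mulrA ler_wpM2l//; first by case/andP: k01 => _ k1; lra.
Qed.

(** After [m] doublings the drift has square norm [4 ^ m] times the original one,
    while the mean square has grown by the smaller factor [(4 - k / 2) ^ m]. *)
Lemma drift_family_invariant_eq0 c q : (forall g, pi g c = c) ->
  drift_family c q -> c = 0.
Proof.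
move=> cfix cq; have iter m : drift_family (c *+ 2 ^ m) ((4 - k / 2) ^+ m * q).
  elim: m => [|m IHm]; first by rewrite expn0 mulr1n expr0 mul1r.
  rewrite expnS mulnC mulrnA exprS -mulrA.
  by apply: drift_family_double => // g; rewrite piMn cfix.
pose r := (4 - k / 2) / 4; have r01 : 0 <= r < 1.
  by case/andP: k01 => k0 k1; rewrite /r; apply/andP; split; lra.
have bound m : `|c| ^+ 2 <= r ^+ m * q.
  have := drift_family_norm (iter m).
  have -> : `|c *+ 2 ^ m| ^+ 2 = `|c| ^+ 2 * 4 ^+ m.
    rewrite normrMn -[`|c| *+ _]mulr_natr exprMn natrX exprAC.
    by congr (_ * _ ^+ m); rewrite -natrX.
  rewrite -ler_pdivlMr ?exprn_gt0// => h; apply: le_trans h _.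
  by rewrite mulrAC -expr_div_n.
have lim0 : r ^+ m * q @[m --> \oo] --> 0 * q.
  apply: cvgM; last exact: cvg_cst.
  by apply: cvg_expr; case/andP: r01 => r0 r1; rewrite ger0_norm.
have : `|c| ^+ 2 <= 0 * q by apply: (cvgr_to_ge lim0); exact: nearW.
rewrite mul0r => c0; apply/eqP; rewrite -normr_eq0 -sqrf_eq0.
by rewrite eq_le c0 sqr_ge0.
Qed.

(** The kernel of the projection to the coinvariants, without closure. A cocycle
    that is a coboundary on each subgroup of a generating family takes its values
    there. *)
Definition coinvariant (c : E) :=
  exists s : seq (G * E), c = \sum_(p <- s) (p.2 - pi p.1 p.2).

Lemma coinvariant_gen g v : coinvariant (v - pi g v).
Proof. by exists [:: (g, v)]; rewrite big_seq1. Qed.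

Lemma coinvariantD c d : coinvariant c -> coinvariant d -> coinvariant (c + d).
Proof. by move=> [s ->] [t ->]; exists (s ++ t); rewrite big_cat. Qed.

Lemma coinvariantN c : coinvariant c -> coinvariant (- c).
Proof.
move=> [s ->]; exists [seq (p.1, - p.2) | p <- s]; rewrite big_map -sumrN.
by apply: eq_bigr => p _ /=; rewrite piN opprB opprK addrC.
Qed.

(** Write [c] as a sum of differences [x - pi g x]; the two equally likely steps
    [x], left unrotated, and [- x], rotated by [g], are centred and drift
    along [c]. *)
Lemma coinvariant_drift_family c : coinvariant c ->
  c = 0 \/ exists q, drift_family c q.
Proof.
move=> [s ->]; have [->|s0] := eqVneq s [::]; first by left; rewrite big_nil.
right; set n := size s; have n0 : (0 < n)%N by rewrite lt0n size_eq0.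
pose p (i : 'I_n) := nth (1%g, 0) s i; pose N := (n + n)%N.
pose gam (b : bool * 'I_n) := if b.1 then 1%g else (p b.2).1.
pose y (b : bool * 'I_n) := if b.1 then (p b.2).2 *+ N else - ((p b.2).2 *+ N).
have cardI : #|{: bool * 'I_n}| = N.
  by rewrite card_prod card_bool card_ord mul2n /N addnn.
exists (\sum_b `|y b| ^+ 2), (bool * 'I_n)%type, gam, y; split.
- by rewrite cardI addn_gt0 n0.
- rewrite -(pair_bigA _ (fun b i => y (b, i))) /= big_bool /= -big_split /=.
  by apply: big1 => i _; rewrite subrr.
- rewrite -(pair_bigA _ (fun b i => pi (gam (b, i)) (y (b, i)))) /= big_bool /=.
  rewrite -big_split /= (big_nth (1%g, 0)) big_mkord cardI -sumrMnl.
  by apply: eq_bigr => i _; rewrite pi1 piN piMn mulrnBl.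
- rewrite ler_peMr ?ler1n ?cardI ?addn_gt0 ?n0//.
  by apply: sumr_ge0 => b _; exact: sqr_ge0.
Qed.

(** A substitute for the invariant complement of the space of invariant vectors
    that works without smoothness of the norm. *)
Lemma invariant_coinvariant_eq0 c : (forall g, pi g c = c) -> coinvariant c -> c = 0.
Proof.
move=> cfix /coinvariant_drift_family[//|[q cq]].
exact: drift_family_invariant_eq0 cfix cq.
Qed.

End InvariantVectors.

(** * Banach spaces: translations are trivial *)

Section BanachRigidity.
Context {R : realType} (XX : metricType R -> Prop) (XX_U : U_closed XX).
Context (XX_geod : forall X, XX X -> uniquely_geodesic X).

(** The displacement [c] of the translation [h] is fixed by the linear part. The
    translation cocycle is a coboundary on each [M i], so [c] also vanishes in
    the coinvariants. *)
Lemma banach_translation_trivial (G : groupType) (X : metricType R)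
    (a : G -> X -> X) (I : Type) (M : I -> set G) h x :
  XX X -> banach_space X -> isometric_action a ->
  (forall i, fixed_points a (M i) !=set0) -> gen (\bigcup_i M i) = setT ->
  translation_at a x h -> a h x = x.
Proof.
move=> XXX [E [f [fbij fd]]] aA Mfix Mgen hT; have [a1 aM aD] := aA.
have uX := XX_geod XXX; have [f' fK f'K] := fbij.
have [k k01 convex_E] := uniform_convexity XX_U XX_geod XXX fd.
pose al g u := f' (a g (f u)); pose pi g u := al g u - al g 0.
have al_iso g u v : `|al g u - al g v| = `|u - v| by rewrite -!fd !f'K aD.
have alM g g' u : al (g * g')%g u = al g (al g' u) by rewrite /al f'K aM.
have al1 u : al 1%g u = u by rewrite /al a1 fK.
(* Isometries preserve midpoints, hence are affine. *)
have al_mid g u v : al g (2^-1 *: (u + v)) = 2^-1 *: (al g u + al g v).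
  apply: (normed_midpoint uX fbij fd); rewrite !al_iso; first exact: normed_midl.
  exact: normed_midr.
have halves (u : E) : 2^-1 *: u + 2^-1 *: u = u.
  by rewrite -scalerDl (_ : 2^-1 + 2^-1 = 1) ?scale1r//; lra.
have al_double g u : al g u + al g u = al g (u + u) + al g 0.
  by have := al_mid g (u + u) 0; rewrite addr0 scalerDr halves => ->; rewrite halves.
have piD g : {morph pi g : u v / u + v}.
  move=> u v; rewrite /pi.
  have h1 : al g (u + v) + al g (u + v) = al g (u + u) + al g (v + v).
    have := al_mid g (u + u) (v + v); rewrite addrACA scalerDr halves => ->.
    by rewrite halves.
  have h2 : al g (u + v) + al g 0 = al g u + al g v.
    rewrite -[LHS]halves -[RHS]halves -!scalerDr; congr (_ *: _).
    by rewrite addrACA h1 [RHS]addrACA (al_double g u) (al_double g v) [RHS]addrACA.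
  by rewrite [RHS]addrACA -h2 addrA addrK.
have pi1 u : pi 1%g u = u by rewrite /pi !al1 subr0.
have pi_norm g u : `|pi g u| = `|u| by rewrite /pi al_iso subr0.
have piB g u v : pi g (u - v) = al g u - al g v.
  have := piD g (u - v) v; rewrite subrK => /eqP; rewrite -subr_eq => /eqP <-.
  by rewrite /pi opprB addrA subrK.
have piM g g' u : pi (g * g')%g u = pi g (pi g' u).
  by rewrite [pi g' u]/pi piB /pi !alM.
pose b g := al g 0.
have bcov g g' : b (g * g')%g = b g + pi g (b g') by rewrite /b /pi alM addrC subrK.
have bcoinv g : coinvariant pi (b g).
  suff sub : subgroup [set g | coinvariant pi (b g)].
    apply: (gen_sub sub (A := \bigcup_i M i)); last by rewrite Mgen.
    move=> m [i _ Mm] /=; have [y /(_ m Mm) my] := Mfix i.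
    suff -> : b m = f' y - pi m (f' y) by exact: coinvariant_gen.
    by rewrite /pi /al f'K my opprB addrC subrK.
  split=> /= [|g1 g2 bg1 bg2|g1 bg1].
  - by exists [::]; rewrite big_nil /b al1.
  - rewrite bcov -[pi g1 _](subKr (b g2)); apply: coinvariantD => //.
    apply: coinvariantD => //; apply/(coinvariantN piD)/coinvariant_gen.
  - have := bcov g1^-1%g g1; rewrite mulVg {1}/b al1 => /eqP.
    rewrite eq_sym addr_eq0 => /eqP ->; rewrite -[pi _ _](subKr (b g1)) opprB.
    apply: coinvariantD; [exact: coinvariant_gen|exact: coinvariantN].
pose y := f' x; pose c := al h y - y.
have cfix g : pi g c = c.
  have par : parallel (f y) (f (al h y)) (f (al g y)) (f (al g (al h y))).
    by rewrite /al /y !f'K; exact: hT.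
  by rewrite /c piB (parallel_normed uX fbij fd par).
have c0 : c = 0.
  apply: (invariant_coinvariant_eq0 k01 convex_E piD pi1 piM pi_norm cfix).
  have -> : c = b h - (y - pi h y).
    by rewrite /c /b /pi opprB addrA [al h 0 + _]addrC subrK.
  by apply: coinvariantD => //; apply/(coinvariantN piD)/coinvariant_gen.
move: c0 => /eqP; rewrite subr_eq0 => /eqP/(congr1 f).
by rewrite /al /y !f'K.
Qed.

End BanachRigidity.

(** * Upgrading fixed points *)

Section Main.
Context {R : realType} (XX : metricType R -> Prop).
Context (XX_complete : forall X, XX X -> metric_complete X).
Context (XX_S : S_plus XX) (XX_U : U_closed XX).
Context (Theta : R -> R) (ThetaP : increasing_continuous Theta).
Context (XX_NPC1 : forall X, XX X -> NPC1 Theta X).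
Context (XX_NPC2 : forall X, XX X -> NPC2 X) (XX_TP : forall X, XX X -> TP X).
Context {G : groupType} (G_fg : fin_gen G) {l : nat} (i0 : 'I_l).
Context (M : 'I_l -> set G) (M_gen : gen (\bigcup_i M i) = setT).
Context (Pi : set (G -> G)) (Pi_sub : aut_subgroup Pi) (Pi_fin : finite_set Pi).
Context (M_F : forall i, relative_F XX (M i)).

Lemma invariant_generating_set : exists S : set G, [/\ finite_set S,
  gen S = setT & forall p s, Pi p -> S s -> S (p s)].
Proof.
have [A Afin Agen] := G_fg; have [_ Pi1 PiM _] := Pi_sub.
exists (\bigcup_(p in Pi) (p @` A)); split.
- by apply: bigcup_finite => // p _; exact: finite_image.
- rewrite -subTset -Agen; apply: gen_sub; first exact: gen_subgroup.
  by move=> g Ag; apply: sub_gen; exists id => //; exists g.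
- move=> p _ Pp [q Pq [g Ag <-]]; exists (p \o q); first exact: PiM.
  by exists g.
Qed.

(** The two halves of the main theorem differ only in the reason why a set of
    translations that may be picked in a move of type I fixes the point. *)
Lemma upgrade_of_rigidity (adm : set G -> Prop) :
  (forall (X : metricType R) (a : G -> X -> X) P x,
    XX X -> isometric_action a -> adm P -> gen P `<=` translation_at a x ->
    forall q, P q -> a q x = x) ->
  winning_strategy adm M Pi -> property_F G XX.
Proof.
move=> rigid win X XXX a aA; apply: contrapT => nofix.
have [S [Sfin Sgen SPi]] := invariant_generating_set.
have [Y [b [XXY bU]]] :=
  uniform_action_exists XX_S XX_U Sfin Sgen XXX (XX_complete XXX) aA nofix.
have [Z [A [z zmin]]] :=
  minimal_configuration_exists ThetaP XX_NPC1 Sfin XX_U i0 M_gen M_F XXY bU.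
have [x xfix] := winning_strategy_minimal_fixed ThetaP XX_NPC1 XX_NPC2 XX_TP M_gen
  Pi_sub SPi rigid win zmin.
have [[_ [_ move_x] _] _] := zmin; have [s _] := move_x x.
by rewrite (xfix s I) mdistxx; lra.
Qed.

End Main.

Local Close Scope ring_scope.
Local Close Scope classical_set_scope.

Theorem theorem3 (R : realType) (XX : metricType R -> Prop)
  (XX_nonempty : exists X, XX X)
  (XX_complete : forall X, XX X -> inhabited X /\ metric_complete X)
  (XX_S : S_plus XX)
  (XX_U : U_closed XX)
  (XX_NPC1 : exists Theta : R -> R, increasing_continuous Theta /\
     forall X, XX X -> NPC1 Theta X)
  (XX_NPC2 : forall X, XX X -> NPC2 X)
  (XX_NPC3 : forall X, XX X -> NPC3 X)
  (XX_TP : forall X, XX X -> TP X)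
  (l : nat) (l3 : 3 <= l)
  (G : groupType) (G_fg : fin_gen G)
  (M : 'I_l -> set G) (M_sub : forall i, subgroup (M i))
  (Pi : set (G -> G)) (Pi_sub : aut_subgroup Pi)
  (M_gen : gen (\bigcup_i M i)%classic = setT)
  (Pi_fin : finite_set Pi)
  (M_F : forall i, relative_F XX (M i)) :
  (Game M Pi -> property_F G XX) /\
  ((forall X, XX X -> banach_space X) \/ (forall X, XX X -> CAT0 X) ->
   Game_plus M Pi -> property_F G XX).
Proof.
case: XX_NPC1 => Theta [ThetaP XX1].
have geod X : XX X -> uniquely_geodesic X by move=> /XX1[].
have cXX X : XX X -> metric_complete X by move=> /XX_complete[].
have i0 : 'I_l by apply: (@Ordinal l 0); apply: leq_trans l3.
have upgrade := @upgrade_of_rigidity R XX cXX XX_S XX_U Theta ThetaP XX1 XX_NPC2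
  XX_TP G G_fg l i0 M M_gen Pi Pi_sub Pi_fin M_F.
split=> [|nice]; apply: upgrade => X a P x XXX aA Padm PT q Pq.
  exact: translations_fix_torsion (geod _ XXX) (XX_NPC2 _ XXX) (XX_NPC3 _ XXX)
    (XX_TP _ XXX) _ aA _ _ Padm PT _ Pq.
have qT : translation_at a x q := PT q (sub_gen Pq).
have Mfix i := M_F i X XXX a aA.
case: nice => [/(_ X XXX) banX|/(_ X XXX) catX].
  exact: banach_translation_trivial XX_U geod _ _ _ _ _ _ _ XXX banX aA Mfix M_gen qT.
exact: CAT0_translation_trivial catX (geod _ XXX) _ _ aA (XX_NPC2 _ XXX)
  (XX_NPC3 _ XXX) (XX_TP _ XXX) _ _ _ _ Mfix M_gen qT.
Qed.
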